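(* Let $R$ be a ring of S-algebraic integers and let $A:\mathrm{Sp}_4(R)\to\mathrm{Sp}_4(R)/[\mathrm{Sp}_4(R),\mathrm{Sp}_4(R)]$ be the abelianization homomorphism. Let $T\subset\mathrm{Sp}_4(R)$ be a subset. Then $T$ normally generates $\mathrm{Sp}_4(R)$ if and only if $\Pi(T)=\emptyset$ and $A(T)$ generates $\mathrm{Sp}_4(R)/[\mathrm{Sp}_4(R),\mathrm{Sp}_4(R)]$.
   Context: A ring of S-algebraic integers is a ring of the form $\mathcal{O}_S=\{a\in K\mid v(a)\geq 0\text{ for all }v\in V-S\}$, where $K$ is a finite field extension of $\mathbb{Q}$, $V$ is the set of all valuations (places) of $K$, and $S\subset V$ is a finite subset containing all archimedean valuations. For a commutative ring $R$ with $1$, $\mathrm{Sp}_4(R)=\{A\in R^{4\times 4}\mid A^TJA=J\}$ with $J=\begin{pmatrix}0_2&I_2\\-I_2&0_2\end{pmatrix}$. A subset $T$ of a group $G$ normally generates $G$ if the smallest normal subgroup of $G$ containing $T$ is $G$. For an ideal $m$ of $R$, $\pi_m:\mathrm{Sp}_4(R)\to\mathrm{Sp}_4(R/m)$ is the entrywise reduction homomorphism. For $T\subset\mathrm{Sp}_4(R)$, $$\Pi(T)=\{m\text{ maximal ideal of }R\mid \pi_m(B)\text{ is central in }\mathrm{Sp}_4(R/m)\text{ for all }B\in T\}.$$ *)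

(* Defs.v *)
From HB Require Import structures.
From mathcomp Require Import all_boot all_order all_algebra all_field.
From mathcomp Require Import generic_quotient ring_quotient.
From mathcomp Require Import boolp classical_sets functions cardinality.
From mathcomp Require Import reals constructive_ereal exp.

Set Implicit Arguments.
Unset Strict Implicit.
Unset Printing Implicit Defensive.

Import Order.TTheory GRing.Theory Num.Theory.

Local Open Scope classical_set_scope.
Local Open Scope quotient_scope.

Section Groups.
Local Open Scope group_scope.
Variable G : groupType.

Definition subgroup (H : set G) : Prop :=
  H 1 /\ forall x y, H x -> H y -> H (x / y).

Definition normal_subgroup (H : set G) : Prop :=
  subgroup H /\ forall x y, H x -> H (x ^ y).

Definition generated (A : set G) : set G := smallest subgroup A.

Definition normal_closure (A : set G) : set G := smallest normal_subgroup A.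

Definition generates (A : set G) : Prop := generated A = setT.

Definition normally_generates (A : set G) : Prop := normal_closure A = setT.

Definition group_center : set G := [set z | forall x, commute z x].

Definition derived_subgroup : set G :=
  generated [set z | exists x y : G, z = [~ x, y]].

Lemma derived_subgroupP : subgroup derived_subgroup.
Proof.
split; first by move=> H [[]].
by move=> x y xD yD H HP; apply: HP.1.2; [apply: xD | apply: yD].
Qed.

Lemma derived1 : derived_subgroup 1. Proof. exact: derived_subgroupP.1. Qed.

Lemma derivedV x : derived_subgroup x -> derived_subgroup x^-1.
Proof. by move=> xD; rewrite -[x^-1]mul1g; exact: derived_subgroupP.2 derived1 xD. Qed.

Lemma derivedM x y :
  derived_subgroup x -> derived_subgroup y -> derived_subgroup (x * y).
Proof.
by move=> xD /derivedV yD; rewrite -[y]invgK; exact: derived_subgroupP.2.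
Qed.

Lemma derivedR x y : derived_subgroup [~ x, y].
Proof. by move=> H [_]; apply; exists x, y. Qed.

Lemma derivedJ x y : derived_subgroup x -> derived_subgroup (x ^ y).
Proof. move=> xD; rewrite (_ : x ^ y = x * [~ x, y]); last by rewrite /commg mulVKg.
exact: derivedM (derivedR _ _). Qed.

Definition abelianization_rel (x y : G) : bool := `[< derived_subgroup (x^-1 * y) >].

Lemma abelianization_relP : equiv_class_of abelianization_rel.
Proof.
split=> [x|x y|y x z].
- by apply/asboolP; rewrite mulVg; exact: derived1.
- by apply/asboolP/asboolP => /derivedV; rewrite invgM invgK.
- move=> /asboolP xy /asboolP yz; apply/asboolP.
  by have := derivedM xy yz; rewrite mulgA mulgK.
Qed.

Canonical abelianization_equiv := EquivRelPack abelianization_relP.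
Canonical abelianization_enc := defaultEncModRel abelianization_rel.

Definition abelianization := {eq_quot abelianization_rel}.
HB.instance Definition _ :
  EqQuotient G abelianization_rel abelianization := EqQuotient.on abelianization.
HB.instance Definition _ := Choice.on abelianization.

Definition ab_one : abelianization := lift_cst abelianization 1.
Definition ab_mul := lift_op2 abelianization (@monoid.mul G).
Definition ab_inv := lift_op1 abelianization (@monoid.inv G).

Canonical pi_ab_one := PiConst ab_one.

Lemma ab_relE x y :
  (x == y %[mod abelianization]) = `[< derived_subgroup (x^-1 * y) >].
Proof. by rewrite piE. Qed.

Lemma derived_repr x :
  derived_subgroup (x^-1 * repr (\pi_abelianization x)).
Proof. by apply/asboolP; rewrite -ab_relE reprK. Qed.

Lemma pi_ab_inv : {morph \pi_abelianization : x / x^-1 >-> ab_inv x}.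
Proof.
move=> x; unlock ab_inv; apply/eqP; rewrite ab_relE; apply/asboolP; rewrite invgK.
have := derivedJ x^-1 (derivedV (derived_repr x)).
by rewrite invgM invgK /conjg invgK mulgA mulgA mulgK.
Qed.
Canonical pi_ab_inv_morph := PiMorph1 pi_ab_inv.

Lemma pi_ab_mul : {morph \pi_abelianization : x y / x * y >-> ab_mul x y}.
Proof.
move=> x y; unlock ab_mul; apply/eqP; rewrite ab_relE; apply/asboolP.
have := derivedM (derivedJ y (derived_repr x)) (derived_repr y).
by rewrite /conjg invgM !mulgA mulgK.
Qed.
Canonical pi_ab_mul_morph := PiMorph2 pi_ab_mul.

Lemma ab_mulA : associative ab_mul.
Proof. by move=> x y z; rewrite -[x]reprK -[y]reprK -[z]reprK !piE mulgA. Qed.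
Lemma ab_mul1 : left_id ab_one ab_mul.
Proof. by move=> x; rewrite -[x]reprK !piE mul1g. Qed.
Lemma ab_mulg1 : right_id ab_one ab_mul.
Proof. by move=> x; rewrite -[x]reprK !piE mulg1. Qed.
Lemma ab_mulV : left_inverse ab_one ab_inv ab_mul.
Proof. by move=> x; rewrite -[x]reprK !piE mulVg. Qed.
Lemma ab_mulgV : right_inverse ab_one ab_inv ab_mul.
Proof. by move=> x; rewrite -[x]reprK !piE mulgV. Qed.

HB.instance Definition _ := isGroup.Build abelianization
  ab_mulA ab_mul1 ab_mulg1 ab_mulV ab_mulgV.

Definition abelianize (x : G) : abelianization := \pi_abelianization x.

End Groups.

Section Symplectic.
Local Open Scope ring_scope.

Definition sympJ (R : comNzRingType) : 'M[R]_4 :=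
  block_mx (0 : 'M_2) (1%:M : 'M_2) (- 1%:M : 'M_2) (0 : 'M_2).

Definition symplectic (R : comNzRingType) : pred 'M[R]_4 :=
  fun A => A^T *m sympJ R *m A == sympJ R.

Record Sp4 (R : comNzRingType) :=
  MkSp4 { Sp4_mx :> 'M[R]_4; Sp4_mxP : symplectic Sp4_mx }.

HB.instance Definition _ (R : comNzRingType) := [isSub for @Sp4_mx R].
HB.instance Definition _ (R : comNzRingType) := [Choice of Sp4 R by <:].

Section Group.
Variable R : comNzRingType.
Local Notation J := (sympJ R).
Implicit Types A B : Sp4 R.

Lemma sympJ_sqr : J *m J = - 1%:M.
Proof.
rewrite (_ : J *m J = (J : 'M_(2 + 2)) *m (J : 'M_(2 + 2))) //.
rewrite /sympJ mulmx_block !mul0mx !mulmx0 mulmx1 mul1mx !addr0 !add0r.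
by rewrite -[RHS]/(- (1%:M : 'M_(2 + 2))) scalar_mx_block opp_block_mx !oppr0.
Qed.

Lemma Sp4E A : (A : 'M_4)^T *m J *m A = J.
Proof. exact/eqP/(Sp4_mxP A). Qed.

Lemma Sp4_mulVmx A : - (J *m (A : 'M_4)^T *m J) *m A = 1%:M.
Proof. by rewrite mulNmx -!mulmxA [_^T *m _]mulmxA Sp4E sympJ_sqr opprK. Qed.

Lemma Sp4_mulmxV A : (A : 'M_4) *m - (J *m (A : 'M_4)^T *m J) = 1%:M.
Proof. exact: mulmx1C (Sp4_mulVmx A). Qed.

Lemma symplectic1 : symplectic (1%:M : 'M[R]_4).
Proof. by rewrite /symplectic trmx1 mul1mx mulmx1. Qed.

Lemma symplecticM A B : symplectic ((A : 'M_4) *m B).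
Proof.
rewrite /symplectic trmx_mul; apply/eqP.
by rewrite -!mulmxA (mulmxA J) (mulmxA _ (J *m A)) (mulmxA _ J) Sp4E mulmxA Sp4E.
Qed.

Lemma symplecticV A : symplectic (- (J *m (A : 'M_4)^T *m J)).
Proof.
have h := Sp4_mulmxV A; set B := - _ in h *.
rewrite /symplectic -{1}(Sp4E A) -!mulmxA h mulmx1 mulmxA -trmx_mul h.
by rewrite trmx1 mul1mx.
Qed.

Definition Sp4_one : Sp4 R := MkSp4 symplectic1.
Definition Sp4_mul A B : Sp4 R := MkSp4 (symplecticM A B).
Definition Sp4_inv A : Sp4 R := MkSp4 (symplecticV A).

Lemma Sp4_mulA : associative Sp4_mul.
Proof. by move=> A B C; apply: val_inj; exact: mulmxA. Qed.
Lemma Sp4_mul1 : left_id Sp4_one Sp4_mul.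
Proof. by move=> A; apply: val_inj; exact: mul1mx. Qed.
Lemma Sp4_mulg1 : right_id Sp4_one Sp4_mul.
Proof. by move=> A; apply: val_inj; exact: mulmx1. Qed.
Lemma Sp4_mulV : left_inverse Sp4_one Sp4_inv Sp4_mul.
Proof. by move=> A; apply: val_inj; exact: Sp4_mulVmx. Qed.
Lemma Sp4_mulgV : right_inverse Sp4_one Sp4_inv Sp4_mul.
Proof. by move=> A; apply: val_inj; exact: Sp4_mulmxV. Qed.

HB.instance Definition _ := isGroup.Build (Sp4 R)
  Sp4_mulA Sp4_mul1 Sp4_mulg1 Sp4_mulV Sp4_mulgV.

End Group.

Section Map.
Variables (R R' : comNzRingType) (f : {rmorphism R -> R'}).

Lemma map_sympJ : map_mx f (sympJ R) = sympJ R'.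
Proof. by rewrite /sympJ (@map_block_mx _ _ f 2 2 2 2) map_mxN !map_mx1 !map_mx0. Qed.

Lemma symplectic_map (A : Sp4 R) : symplectic (map_mx f A).
Proof. by rewrite /symplectic map_trmx -map_sympJ -!map_mxM Sp4E. Qed.

Definition Sp4_map (A : Sp4 R) : Sp4 R' := MkSp4 (symplectic_map A).

End Map.

Definition maximal_ideal (R : comNzRingType) (m : idealr R) : Prop :=
  forall I : idealr R, {subset m <= I} -> I =i m.

Definition Sp4_red (R : comNzRingType) (m : idealr R) :
    Sp4 R -> Sp4 {ideal_quot m} :=
  Sp4_map (\pi_{ideal_quot m} : {rmorphism R -> {ideal_quot m}}).

(* The members of [Pi_set T] are ideals as subsets of [R]; an [idealr R] is a
   proper ideal given by a boolean predicate, and classically every proper ideal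
   is of this form. *)
Definition Pi_set (R : comNzRingType) (T : set (Sp4 R)) : set (set R) :=
  [set M | exists m : idealr R,
    [/\ M = [set x | x \in m], maximal_ideal m &
        forall B, T B -> group_center (Sp4_red m B)]].

End Symplectic.

Section Places.
Local Open Scope ring_scope.
Variables (RR : realType) (K : fieldType).

Record absval := AbsVal {
  absv :> K -> RR;
  absv_ge0 : forall x, 0 <= absv x;
  absv_eq0 : forall x, absv x = 0 <-> x = 0;
  absvM : forall x y, absv (x * y) = absv x * absv y;
  absvD : forall x y, absv (x + y) <= absv x + absv y;
  absv_nontrivial : exists2 x, x != 0 & absv x != 1 }.

Definition absval_equiv (v w : absval) : Prop :=
  exists2 s : RR, 0 < s & forall x, w x = v x `^ s.

Definition nonarchimedean (v : absval) : Prop :=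
  forall x y, v (x + y) <= Num.max (v x) (v y).

Definition places : set (set absval) :=
  [set P | exists v, P = [set w | absval_equiv v w]].

Definition archimedean_places : set (set absval) :=
  [set P | places P /\ exists2 v, P v & ~ nonarchimedean v].

Record place_set := PlaceSet {
  place_set_places :> set (set absval);
  place_set_sub : place_set_places `<=` places;
  place_set_finite : finite_set place_set_places;
  place_set_arch : archimedean_places `<=` place_set_places }.

(* The exponential valuation - log |a| attached to an absolute value; the sign
   of its values does not depend on the representative of the place. *)
Definition valuation (v : absval) (a : K) : \bar RR :=
  if a == 0 then +oo%E else (- ln (v a))%:E.

Definition S_integral (S : place_set) : pred K := fun a =>
  `[< forall P, (places `\` S) P -> forall v, P v -> (0 <= valuation v a)%E >].

Lemma valuation_ge0 (v : absval) a : (0 <= valuation v a)%E = (v a <= 1).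
Proof.
rewrite /valuation; have [->|a0] := eqVneq.
  by rewrite leey ((absv_eq0 v 0).2 erefl) ler01.
have va0 : 0 < v a.
  rewrite lt_neqAle absv_ge0 andbT eq_sym; apply/eqP => /absv_eq0 a_0.
  by rewrite a_0 eqxx in a0.
rewrite lee_fin oppr_ge0; apply/idP/idP => h; last exact: ln_le0.
by rewrite -ler_ln ?posrE// ln1.
Qed.

Lemma absv1 (v : absval) : v 1 = 1.
Proof.
have v1 : v 1 != 0 by apply/eqP => /absv_eq0 /eqP; rewrite oner_eq0.
by apply: (mulfI v1); rewrite -absvM !mulr1.
Qed.

Lemma absvN (v : absval) x : v (- x) = v x.
Proof.
suff vN1 : v (-1) = 1 by rewrite -mulN1r absvM vN1 mul1r.
by apply/eqP; rewrite -(@eqrXn2 _ 2) ?absv_ge0// expr1n expr2 -absvM mulrNN mulr1 absv1.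
Qed.

Lemma S_integral_subring (S : place_set) : subring_closed (S_integral S).
Proof.
split.
- by apply/asboolP => P _ v _; rewrite valuation_ge0 absv1.
- move=> x y /asboolP hx /asboolP hy; apply/asboolP => P PS v Pv.
  move: (hx P PS v Pv) (hy P PS v Pv); rewrite !valuation_ge0 => vx vy.
  have na : nonarchimedean v.
    apply: contrapT => nna; apply: PS.2; apply: place_set_arch.
    by split; [exact: PS.1 | exists v].
  by apply: le_trans (na _ _) _; rewrite absvN ge_max vx vy.
- move=> x y /asboolP hx /asboolP hy; apply/asboolP => P PS v Pv.
  move: (hx P PS v Pv) (hy P PS v Pv); rewrite !valuation_ge0 => vx vy.
  by rewrite absvM mulr_ile1 // absv_ge0.
Qed.

HB.instance Definition _ (S : place_set) :=
  GRing.isSubringClosed.Build K (S_integral S) (S_integral_subring S).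

Record S_integers (S : place_set) :=
  MkSInt { Sint_val :> K; Sint_valP : Sint_val \in S_integral S }.

HB.instance Definition _ (S : place_set) := [isSub for @Sint_val S].
HB.instance Definition _ (S : place_set) := [Choice of S_integers S by <:].
HB.instance Definition _ (S : place_set) :=
  [SubChoice_isSubComNzRing of S_integers S by <:].

End Places.

(* Main.v *)
(** Let [N] be the normal closure of [T] in [G = Sp4(R)]. That [A(T)]
    generates the abelianization says exactly that [G / N] is perfect, so [N
    = G] as soon as [G / N] is shown to be solvable.

    If [N] contains all root elements with parameter in [c R] and [G = N
    G(c)], where [G(c)] is the principal congruence subgroup, then a
    stable-range reduction gives [G(c)] as a product of elements of [N] and
    of two commuting copies of [SL_2]. These are exchanged by a Weyl
    element, which itself lies in [N G(c)], and this forces [G / N] to be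
    abelian.

    Writing [T_{v,r}] for the transvection [z -> z + r omega(v, z) v], call
    [x] and [y] linked if [T_{x,r} = T_{y,r}] modulo [N] for all [r]. This
    is a [G]-invariant equivalence that links [x] to [A x] for every [A] in
    [N]. Polarization inside an equivalence class produces the level [c].
    Modulo a maximal ideal [m] the equivalence is transitive up to scalars,
    and Iwasawa's criterion gives [G = N G(m)]. The ideals [J] with [G = N
    G(J)] are stable under products since [[G(I), G(J)] <= G(I J)] and [G /
    N] is perfect, so Noetherian induction gives [G = N G(c)].

    Of the ring only this is used: it is a domain of characteristic zero
    whose additive group has finite rank. *)

From HB Require Import structures.
Require Import Defs.
From mathcomp Require Import all_boot all_order all_algebra all_field.
From mathcomp Require Import generic_quotient ring_quotient.
From mathcomp Require Import ring zify boolp classical_sets reals.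

Set Implicit Arguments.
Unset Strict Implicit.
Unset Printing Implicit Defensive.

Import Order.TTheory GRing.Theory Num.Theory.

Local Open Scope classical_set_scope.

(** * Congruence modulo a normal subgroup, perfect quotients and the abelianization *)

Section NormalSubgroups.
Local Open Scope group_scope.
Variable G : groupType.
Implicit Types (g h x y : G) (H N M : set G).

Lemma subgroupV H x : subgroup H -> H x -> H x^-1.
Proof. by case=> H1 HV Hx; rewrite -[x^-1]mul1g; exact: HV. Qed.

Lemma subgroupM H x y : subgroup H -> H x -> H y -> H (x * y).
Proof.
by move=> sH Hx Hy; rewrite -[y]invgK; apply: sH.2 => //; exact: subgroupV.
Qed.

Definition prodset N H : set G := [set g | exists n h, [/\ N n, H h & g = n * h]].

Lemma prodset_subl N H : H 1 -> N `<=` prodset N H.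
Proof. by move=> H1 n Nn; exists n, 1; rewrite mulg1. Qed.

Lemma prodset_subr N H : N 1 -> H `<=` prodset N H.
Proof. by move=> N1 h Hh; exists 1, h; rewrite mul1g. Qed.

Lemma prodset_subgroup N H :
  normal_subgroup N -> subgroup H -> subgroup (prodset N H).
Proof.
move=> [sN nN] sH; split.
  by exists 1, 1; rewrite mulg1; split; [case: sN|case: sH|].
move=> _ _ [n [h [Nn Hh ->]]] [n' [h' [Nn' Hh' ->]]].
exists (n * n'^-1 ^ (h * h'^-1)^-1), (h * h'^-1); split.
- by apply: subgroupM => //; apply: nN; exact: subgroupV.
- exact: sH.2.
- by rewrite conjgE !invgM !invgK !mulgA mulgVK mulgK.
Qed.

(** Serves Iwasawa's argument, where [H] is a root subgroup whose conjugates fall back into it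
    modulo [N]. *)
Lemma prodset_normal N H : normal_subgroup N -> subgroup H ->
  (forall h g, H h -> prodset N H (h ^ g)) -> normal_subgroup (prodset N H).
Proof.
move=> nN sH HJ; have sNH := prodset_subgroup nN sH; split=> //.
move=> _ g [n [h [Nn Hh ->]]]; rewrite conjMg; apply: subgroupM => //; last exact: HJ.
by apply: prodset_subl; [case: sH|exact: nN.2].
Qed.

Lemma prodset_normal2 N H :
  normal_subgroup N -> normal_subgroup H -> normal_subgroup (prodset N H).
Proof.
move=> nN [sH nH]; apply: prodset_normal => // h g Hh.
by apply: prodset_subr; [case: nN => -[]|exact: nH].
Qed.

Definition eqmod N x y := N (x / y).

Section EqMod.
Variable N : set G.
Hypothesis nN : normal_subgroup N.

Lemma eqmod_refl x : eqmod N x x.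
Proof. by rewrite /eqmod mulgV; case: nN => -[]. Qed.

Lemma eqmod_sym x y : eqmod N x y -> eqmod N y x.
Proof. by move=> /(subgroupV nN.1); rewrite invgM invgK. Qed.

Lemma eqmod_trans y x z : eqmod N x y -> eqmod N y z -> eqmod N x z.
Proof. by move=> xy /(subgroupM nN.1 xy); rewrite mulgA mulgVK. Qed.

Lemma eqmodM x x' y y' : eqmod N x x' -> eqmod N y y' -> eqmod N (x * y) (x' * y').
Proof.
move=> xx yy; have /(subgroupM nN.1)/(_ xx) : N ((y / y') ^ x^-1) by exact: nN.2.
by rewrite /eqmod conjgE !invgM !invgK !mulgA mulgVK.
Qed.

Lemma eqmodV x x' : eqmod N x x' -> eqmod N x^-1 x'^-1.
Proof.
by move=> /eqmod_sym/(nN.2 _ x); rewrite /eqmod conjgE invgK mulgVK.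
Qed.

Lemma eqmodJ x x' y y' : eqmod N x x' -> eqmod N y y' -> eqmod N (x ^ y) (x' ^ y').
Proof. by move=> ? ?; apply: eqmodM; [exact: eqmodV|exact: eqmodM]. Qed.

Lemma eqmodR x x' y y' : eqmod N x x' -> eqmod N y y' -> eqmod N [~ x, y] [~ x', y'].
Proof. by move=> ? ?; apply: eqmodM; [exact: eqmodV|exact: eqmodJ]. Qed.

Lemma eqmod1 x : eqmod N x 1 -> N x.
Proof. by rewrite /eqmod invg1 mulg1. Qed.

Lemma eqmod_mul n x : N n -> eqmod N (n * x) x.
Proof. by rewrite /eqmod mulgK. Qed.

(* Modulo [N], both [X] and [Y] are normal in the group [X Y], so conjugation by
   [w] both swaps and preserves them: they coincide modulo [N] and commute. *)
Lemma commutator_sub_of_swap (X Y : set G) w :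
  subgroup X -> subgroup Y -> (forall x y, X x -> Y y -> commute x y) ->
  (forall x, X x -> Y (x ^ w)) -> (forall y, Y y -> X (y ^ w)) ->
  (forall g, exists n x y, [/\ N n, X x, Y y & g = n * x * y]) ->
  forall g h, N [~ g, h].
Proof.
move=> sX sY cXY Xw Yw dec.
have dec' g : exists x y, [/\ X x, Y y & eqmod N g (x * y)].
  have [n [x [y [Nn Xx Yy ->]]]] := dec g.
  by exists x, y; split=> //; rewrite -mulgA; exact: eqmod_mul.
have [x0 [y0 [Xx0 Yy0 w_xy]]] := dec' w.
have cj x y : commute x y -> x ^ y = x.
  by move=> c; rewrite conjgE c mulKg.
have XY x : X x -> exists2 y, Y y & eqmod N x y.
  move=> Xx; have Xx' : X (x ^ x0^-1).
    by rewrite conjgE invgK; do 2?[apply: subgroupM => //]; exact: subgroupV.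
  exists ((x ^ x0^-1) ^ w); first exact: Xw.
  have := eqmodJ (eqmod_refl (x ^ x0^-1)) (eqmod_sym w_xy).
  by rewrite conjgM conjgKV cj //; exact: cXY.
have YX y : Y y -> exists2 x, X x & eqmod N y x.
  move=> Yy; have Yy' : Y (y ^ y0^-1).
    by rewrite conjgE invgK; do 2?[apply: subgroupM => //]; exact: subgroupV.
  exists ((y ^ y0^-1) ^ w); first exact: Yw.
  have := eqmodJ (eqmod_refl (y ^ y0^-1)) (eqmod_sym w_xy).
  by rewrite conjgM (cj _ x0) ?conjgKV//; apply: commute_sym; exact: cXY.
move=> g h; apply: eqmod1.
have [x [y [Xx Yy gxy]]] := dec' g; have [x' [y' [Xx' Yy' hxy]]] := dec' h.
have [z Yz xz] := XY x Xx; have [z' Xz' xz'] := YX y' Yy'.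
have gzy : eqmod N g (z * y).
  by apply: eqmod_trans gxy _; apply: eqmodM => //; exact: eqmod_refl.
have hxz : eqmod N h (x' * z').
  by apply: eqmod_trans hxy _; apply: eqmodM => //; exact: eqmod_refl.
have := eqmodR gzy hxz; suff -> : [~ z * y, x' * z'] = 1 by [].
apply/eqP/commgP; apply: commute_sym; apply: cXY; exact: subgroupM.
Qed.

End EqMod.

(** For normal [N], perfectness of [G / N] expressed inside [G]: only [G] itself is a normal
    subgroup above [N] with abelian quotient. *)
Definition perfect_mod N := forall M, normal_subgroup M -> N `<=` M ->
  (forall x y, M [~ x, y]) -> forall g, M g.

Lemma perfect_mod_sub N M : N `<=` M -> perfect_mod N -> perfect_mod M.
Proof. by move=> NM pN L nL ML; apply: pN => // x Nx; apply: ML; exact: NM. Qed.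

(** Modulo [N L] both [M1] and [M2] cover the group and they commute, so the quotient is abelian;
    perfectness makes it trivial. *)
Lemma perfect_mod_comm N M1 M2 L : normal_subgroup N -> perfect_mod N ->
  normal_subgroup L ->
  (forall g, prodset N M1 g) -> (forall g, prodset N M2 g) ->
  (forall g h, M1 g -> M2 h -> L [~ g, h]) -> forall g, prodset N L g.
Proof.
move=> nN pN nL N1 N2 cL; have [[L1 _] _] := nL; have [[N_1 _] _] := nN.
have nNL := prodset_normal2 nN nL.
apply: pN => //; first exact: prodset_subl.
move=> x y; have [n [g [Nn Mg ->]]] := N1 x; have [n' [h [Nn' Mh ->]]] := N2 y.
have NE z z' : eqmod N z z' -> eqmod (prodset N L) z z'.
  by rewrite /eqmod => /(prodset_subl L1).
apply: eqmod1; apply: (eqmod_trans nNL) (eqmodR nNL _ _) _.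
- by apply: NE; exact: eqmod_mul.
- by apply: NE; exact: eqmod_mul.
by rewrite /eqmod invg1 mulg1; apply: prodset_subr => //; exact: cL.
Qed.

Lemma normal_closure_normal (T : set G) : normal_subgroup (normal_closure T).
Proof.
split; first split; first by move=> H [[[]]].
- by move=> x y Nx Ny H HT; apply: HT.1.1.2; [exact: Nx|exact: Ny].
- by move=> x y Nx H HT; apply: HT.1.2; exact: Nx.
Qed.

Lemma normal_closure_sub (T : set G) : T `<=` normal_closure T.
Proof. by move=> x Tx H [_]; exact. Qed.

Lemma normal_closure_min (T : set G) N :
  normal_subgroup N -> T `<=` N -> normal_closure T `<=` N.
Proof. by move=> nN TN x; apply; split. Qed.

Lemma abelianizeM x y : abelianize (x * y) = abelianize x * abelianize y.
Proof. exact: pi_ab_mul. Qed.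

Lemma abelianizeV x : abelianize x^-1 = (abelianize x)^-1.
Proof. exact: pi_ab_inv. Qed.

Lemma abelianize_eq x y : abelianize x = abelianize y <-> derived_subgroup (x^-1 * y).
Proof.
split=> [/eqP|d]; first by rewrite /abelianize ab_relE => /asboolP.
by apply/eqP; rewrite ab_relE; exact/asboolP.
Qed.

Lemma abelianize1 : abelianize (1 : G) = 1.
Proof. by rewrite -(mulgV (1 : G)) abelianizeM abelianizeV mulgV. Qed.

Lemma abelianizeJ x y : abelianize (x ^ y) = abelianize x.
Proof.
apply/esym/abelianize_eq; exact: derivedR.
Qed.

(** A normal [M] with abelian quotient contains the derived subgroup, hence is the full preimage of
    its image; that image is a subgroup containing the image of [T]. *)
Lemma perfect_mod_of_generates (T : set G) :
  generates (@abelianize G @` T) -> perfect_mod (normal_closure T).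
Proof.
move=> gT M nM TM cM g.
have dM : @derived_subgroup G `<=` M.
  by move=> x; apply; split; [exact: nM.1|move=> _ [y [z ->]]].
pose A := [set z | exists2 x, M x & z = abelianize x].
have sA : subgroup A.
  split; first by exists 1; [case: nM => -[]|rewrite abelianize1].
  move=> _ _ [x Mx ->] [y My ->]; exists (x / y); first exact: nM.1.2.
  by rewrite abelianizeM abelianizeV.
have : generated (@abelianize G @` T) (abelianize g) by rewrite gT.
case/(_ A); first split=> //.
  by move=> _ [x Tx <-]; exists x => //; apply: TM; exact: normal_closure_sub.
move=> x Mx /esym/abelianize_eq/dM xg.
by rewrite -(mulVKg x g); apply: subgroupM => //; exact: nM.1.
Qed.

(** The preimage of the subgroup generated by the image of [T] is normal, because [abelianize] is
    constant on conjugacy classes. *)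
Lemma generates_of_normally_generates (T : set G) :
  normally_generates T -> generates (@abelianize G @` T).
Proof.
move=> nT; apply/seteqP; split=> // z _; rewrite -[z]reprK.
suff h : normal_closure T `<=` [set x | generated (@abelianize G @` T) (abelianize x)].
  by apply: h; rewrite nT.
apply: normal_closure_min; last first.
  by move=> x Tx H [_]; apply; exists x.
split; first split.
- by rewrite /= abelianize1 => H [[]].
- move=> x y /= gx gy; rewrite abelianizeM abelianizeV => H HT.
  by apply: HT.1.2; [exact: gx|exact: gy].
- by move=> x y /=; rewrite abelianizeJ.
Qed.

End NormalSubgroups.

Local Open Scope quotient_scope.
Local Open Scope ring_scope.

Notation i0 := (@Ordinal 4 0 isT).
Notation i1 := (@Ordinal 4 1 isT).
Notation i2 := (@Ordinal 4 2 isT).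
Notation i3 := (@Ordinal 4 3 isT).

Lemma ord4P (P : 'I_4 -> Prop) : P i0 -> P i1 -> P i2 -> P i3 -> forall i, P i.
Proof.
move=> P0 P1 P2 P3 [[|[|[|[|//]]]] lt4];
 by [rewrite (_ : Ordinal _ = i0) //; exact: val_inj
    |rewrite (_ : Ordinal _ = i1) //; exact: val_inj
    |rewrite (_ : Ordinal _ = i2) //; exact: val_inj
    |rewrite (_ : Ordinal _ = i3) //; exact: val_inj].
Qed.

Lemma sum_ord4 (V : nmodType) (F : 'I_4 -> V) :
  \sum_(i < 4) F i = F i0 + F i1 + F i2 + F i3.
Proof.
rewrite !big_ord_recl big_ord0 addr0 !addrA.
by congr (F _ + F _ + F _ + F _); exact: val_inj.
Qed.

(** * Transvections *)

Section Symplectic.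
Variable R : comNzRingType.
Implicit Types (a b c d p q r s : R) (u v w x y z : 'cV[R]_4) (g h : Sp4 R).

Definition mx4 (L : seq (seq R)) : 'M[R]_4 := \matrix_(i, j) (nth [::] L i)`_j.

Lemma sympJE : sympJ R = mx4 [:: [:: 0; 0; 1; 0]; [:: 0; 0; 0; 1];
                                   [:: -1; 0; 0; 0]; [:: 0; -1; 0; 0]].
Proof.
apply/matrixP; elim/ord4P; elim/ord4P; rewrite /sympJ /mx4 mxE [RHS]mxE.
all: case: splitP => -[[|[|//]] ?] //= _; rewrite !mxE.
all: by case: splitP => -[[|[|//]] ?] //= _; rewrite !mxE //= ?mulr0n ?mulr1n ?oppr0.
Qed.

Definition vec4 a b c d : 'cV[R]_4 := \col_i [:: a; b; c; d]`_i.

Lemma cV4P x y : x i0 0 = y i0 0 -> x i1 0 = y i1 0 ->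
  x i2 0 = y i2 0 -> x i3 0 = y i3 0 -> x = y.
Proof. by move=> ? ? ? ?; apply/colP; elim/ord4P. Qed.

Definition omega x y : R :=
  x i0 0 * y i2 0 + x i1 0 * y i3 0 - x i2 0 * y i0 0 - x i3 0 * y i1 0.

Lemma omegaE x y : omega x y = (x^T *m sympJ R *m y) 0 0.
Proof.
by rewrite sympJE !mxE sum_ord4 !mxE !sum_ord4 !mxE /= /omega; ring.
Qed.

Lemma symplecticP (A : 'M[R]_4) :
  symplectic A <-> forall x y, omega (A *m x) (A *m y) = omega x y.
Proof.
split=> [/eqP sA x y|sA].
  by rewrite !omegaE trmx_mul -!mulmxA (mulmxA A^T) (mulmxA (A^T *m _)) sA.
apply/eqP/matrixP => i j.
have mxe (B : 'M[R]_4) :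
    B i j = ((delta_mx i 0 : 'cV_4)^T *m B *m (delta_mx j 0 : 'cV_4)) 0 0.
  by rewrite trmx_delta -rowE -colE !mxE.
by rewrite !mxe -omegaE -sA omegaE trmx_mul !mulmxA.
Qed.

Definition act g x : 'cV[R]_4 := (g : 'M[R]_4) *m x.

Lemma act1 x : act 1%g x = x. Proof. exact: mul1mx. Qed.
Lemma actM g h x : act (g * h)%g x = act g (act h x).
Proof. by rewrite /act mulmxA. Qed.
Lemma actVK g x : act g^-1%g (act g x) = x.
Proof. by rewrite -actM mulVg act1. Qed.
Lemma actKV g x : act g (act g^-1%g x) = x.
Proof. by rewrite -actM mulgV act1. Qed.
Lemma actD g x y : act g (x + y) = act g x + act g y.
Proof. exact: mulmxDr. Qed.
Lemma actB g x y : act g (x - y) = act g x - act g y.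
Proof. exact: mulmxBr. Qed.
Lemma actZ g a x : act g (a *: x) = a *: act g x.
Proof. by rewrite /act -scalemxAr. Qed.
Lemma omega_act g x y : omega (act g x) (act g y) = omega x y.
Proof. by have /symplecticP := Sp4_mxP g; apply. Qed.

Lemma Sp4_ext g h : (forall x, act g x = act h x) -> g = h.
Proof.
move=> gh; apply: val_inj; apply/matrixP => i j.
by have /colP/(_ i) := gh (delta_mx j 0); rewrite /act -!colE !mxE.
Qed.

Lemma omegaC x y : omega y x = - omega x y.
Proof. by rewrite /omega; ring. Qed.
Lemma omegaxx x : omega x x = 0.
Proof. by rewrite /omega; ring. Qed.
Lemma omegaDl x y z : omega (x + y) z = omega x z + omega y z.
Proof. by rewrite /omega !mxE; ring. Qed.
Lemma omegaDr x y z : omega z (x + y) = omega z x + omega z y.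
Proof. by rewrite /omega !mxE; ring. Qed.
Lemma omegaZl a x z : omega (a *: x) z = a * omega x z.
Proof. by rewrite /omega !mxE; ring. Qed.
Lemma omegaZr a x z : omega z (a *: x) = a * omega z x.
Proof. by rewrite /omega !mxE; ring. Qed.

Lemma omegaNl x z : omega (- x) z = - omega x z.
Proof. by rewrite /omega !mxE; ring. Qed.
Lemma omegaNr x z : omega z (- x) = - omega z x.
Proof. by rewrite /omega !mxE; ring. Qed.

Fact tv_symplectic v r :
  symplectic (1%:M + r *: (v *m (v^T *m sympJ R))).
Proof.
have E x : (1%:M + r *: (v *m (v^T *m sympJ R))) *m x = x + (r * omega v x) *: v.
  rewrite mulmxDl mul1mx -scalemxAl -mulmxA [_ *m x]mx11_scalar -omegaE.
  by rewrite mul_mx_scalar scalerA.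
by apply/symplecticP => x y; rewrite !E /omega !mxE; ring.
Qed.

Definition tv v r : Sp4 R := MkSp4 (tv_symplectic v r).

Lemma tvE v r x : act (tv v r) x = x + (r * omega v x) *: v.
Proof.
rewrite /act /= mulmxDl mul1mx -scalemxAl -mulmxA [_ *m x]mx11_scalar -omegaE.
by rewrite mul_mx_scalar scalerA.
Qed.

Lemma tvD v r s : tv v (r + s) = (tv v r * tv v s)%g.
Proof.
apply: Sp4_ext => x; rewrite actM !tvE omegaDr omegaZr omegaxx mulr0 addr0.
by rewrite mulrDl scalerDl addrA addrAC.
Qed.

Lemma tv0 v : tv v 0 = 1%g.
Proof. by apply: Sp4_ext => x; rewrite tvE mul0r scale0r addr0 act1. Qed.

Lemma tvN v r : tv v (- r) = (tv v r)^-1%g.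
Proof. by apply/esym/mulg1_eq; rewrite -tvD subrr tv0. Qed.

Lemma tvZ a v r : tv (a *: v) r = tv v (a ^+ 2 * r).
Proof.
by apply: Sp4_ext => x; rewrite !tvE omegaZl scalerA; congr (_ + _ *: _); ring.
Qed.

Lemma tvJ v r g : (tv v r ^ g)%g = tv (act g^-1%g v) r.
Proof.
apply: Sp4_ext => x; rewrite conjgE !actM !tvE actD actVK actZ.
by congr (_ + (_ * _) *: _); rewrite -[RHS](omega_act g) actKV.
Qed.

(* For orthogonal [x] and [y] this polarizes [tv]; it is a short root element when
   [x] and [y] are basis vectors. *)
Definition mv x y r : Sp4 R := (tv (x + y) r * tv x (- r) * tv y (- r))%g.

Lemma mvE x y r z : omega x y = 0 ->
  act (mv x y r) z = z + (r * omega x z) *: y + (r * omega y z) *: x.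
Proof.
move=> xy; have yx : omega y x = 0 by rewrite omegaC xy oppr0.
rewrite /mv !actM !tvE; rewrite !(omegaDl, omegaDr, omegaZr, omegaxx, xy, yx).
by apply: cV4P; rewrite !mxE; ring.
Qed.

Definition e1 := vec4 1 0 0 0.
Definition e2 := vec4 0 1 0 0.
Definition f1 := vec4 0 0 1 0.
Definition f2 := vec4 0 0 0 1.

Lemma cV4_basis x : x = x i0 0 *: e1 + x i1 0 *: e2 + x i2 0 *: f1 + x i3 0 *: f2.
Proof. by apply: cV4P; rewrite !mxE /=; ring. Qed.

(** The copy of [SL_2] on the hyperbolic plane of [e1] and [f1]. *)
Fact emb_symplectic p q r s : p * s - q * r = 1 ->
  symplectic (mx4 [:: [:: p; 0; q; 0]; [:: 0; 1; 0; 0];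
                      [:: r; 0; s; 0]; [:: 0; 0; 0; 1]]).
Proof.
move=> det1; apply/symplecticP => x y; rewrite /omega !mxE !sum_ord4 !mxE /=.
apply/eqP; rewrite -subr_eq0; apply/eqP.
transitivity ((p * s - q * r - 1) * (x i0 0 * y i2 0 - x i2 0 * y i0 0)); first by ring.
by rewrite det1 subrr mul0r.
Qed.

Definition emb p q r s (h : p * s - q * r = 1) : Sp4 R := MkSp4 (emb_symplectic h).

Lemma embE p q r s (h : p * s - q * r = 1) x :
  act (emb h) x =
  vec4 (p * x i0 0 + q * x i2 0) (x i1 0) (r * x i0 0 + s * x i2 0) (x i3 0).
Proof. by apply: cV4P; rewrite /act !mxE !sum_ord4 !mxE /=; ring. Qed.

(** The Weyl element exchanging the planes of [e1], [f1] and of [e2], [f2]. *)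
Fact swap_symplectic :
  symplectic (mx4 [:: [:: 0; 1; 0; 0]; [:: 1; 0; 0; 0];
                      [:: 0; 0; 0; 1]; [:: 0; 0; 1; 0]] : 'M[R]_4).
Proof.
by apply/symplecticP => x y; rewrite /omega !mxE !sum_ord4 !mxE /=; ring.
Qed.

Definition swap : Sp4 R := MkSp4 swap_symplectic.

Lemma swapE x : act swap x = vec4 (x i1 0) (x i0 0) (x i3 0) (x i2 0).
Proof. by apply: cV4P; rewrite /act !mxE !sum_ord4 !mxE /=; ring. Qed.

End Symplectic.

(** * Congruence subgroups *)

Section Congruence.
Variable R : comNzRingType.
Implicit Types (a b c d p q r s t u : R) (v w x y z : 'cV[R]_4) (g h : Sp4 R).
Implicit Types (I J : set R) (N : set (Sp4 R)).

Local Notation e1 := (e1 R).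
Local Notation e2 := (e2 R).
Local Notation f1 := (f1 R).
Local Notation f2 := (f2 R).

Definition is_ideal J :=
  [/\ J 0, (forall a b, J a -> J b -> J (a + b)) & forall a b, J b -> J (a * b)].

Definition principal c : set R := [set a | exists b, a = c * b].

Lemma principal_ideal c : is_ideal (principal c).
Proof.
split; first by exists 0; rewrite mulr0.
  by move=> _ _ [a ->] [b ->]; exists (a + b); rewrite mulrDr.
by move=> a _ [b ->]; exists (a * b); rewrite mulrCA.
Qed.

Lemma idealN J a : is_ideal J -> J a -> J (- a).
Proof. by case=> _ _ JM Ja; rewrite -mulN1r; exact: JM. Qed.

Lemma idealB J a b : is_ideal J -> J a -> J b -> J (a - b).
Proof. by move=> iJ Ja Jb; case: (iJ) => _ JD _; apply: JD => //; exact: idealN. Qed.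

Definition congv J x y := forall i, J (x i 0 - y i 0).

Definition congruence_subgroup J : set (Sp4 R) :=
  [set g | forall x, congv J (act g x) x].

Section Cong.
Variable J : set R.
Hypothesis iJ : is_ideal J.

Let J0 : J 0. Proof. by case: iJ. Qed.
Let JD a b : J a -> J b -> J (a + b). Proof. by case: iJ => _ + _; exact. Qed.
Let JM a b : J b -> J (a * b). Proof. by case: iJ => _ _; exact. Qed.

Lemma congv_refl x : congv J x x. Proof. by move=> i; rewrite subrr. Qed.

Lemma congv_sym x y : congv J x y -> congv J y x.
Proof. by move=> xy i; rewrite -opprB; exact: idealN. Qed.

Lemma congv_trans y x z : congv J x y -> congv J y z -> congv J x z.
Proof. by move=> xy yz i; rewrite -(subrKA (y i 0)); exact: JD. Qed.

Lemma congv_act g x y : congv J x y -> congv J (act g x) (act g y).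
Proof.
move=> xy i; rewrite !mxE -sumrB; elim/big_ind: _ => // j _.
by rewrite -mulrBr; exact: JM.
Qed.

Lemma congruence_normal : normal_subgroup (congruence_subgroup J).
Proof.
split; first split; first by move=> x; rewrite act1; exact: congv_refl.
  move=> g h Gg Gh x; rewrite actM; apply: congv_trans (Gg _) _.
  by apply: congv_sym; have := Gh (act h^-1%g x); rewrite actKV.
move=> g h Gg x; rewrite conjgE !actM -[X in congv J _ X](actVK h).
by apply: congv_act; exact: Gg.
Qed.

Lemma congv_omega x x' y y' :
  congv J x x' -> congv J y y' -> J (omega x y - omega x' y').
Proof.
move=> xx yy; rewrite (_ : omega x y - omega x' y' =
  omega (x - x') y + omega x' (y - y')); last by rewrite /omega !mxE; ring.
rewrite /omega !mxE; repeat first [apply: JD|apply: (idealB iJ)|apply: (idealN iJ)].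
all: try by apply: JM; exact: yy.
all: by rewrite mulrC; apply: JM; exact: xx.
Qed.

Lemma tv_cong v w r : congv J v w -> congruence_subgroup J (tv v r / tv w r)%g.
Proof.
move=> vw z; rewrite -tvN actM !tvE.
(* With [z'] the image of [z] under [tv w (- r)], both transvections are compared at the single
   vector [z']. *)
set z' := z + _; have -> : z = z' + (r * omega w z') *: w.
  by rewrite /z' omegaDr omegaZr omegaxx mulr0 addr0 mulNr scaleNr subrK.
move=> i; rewrite !mxE opprD addrACA subrr add0r.
rewrite -!mulrA -mulrBr; apply: JM.
rewrite (_ : _ - _ = omega v z' * (v i 0 - w i 0) +
  w i 0 * (omega v z' - omega w z')); last by ring.
by apply: JD; apply: JM => //; apply: congv_omega => //; exact: congv_refl.
Qed.

Lemma tv_congruence v r : J r -> congruence_subgroup J (tv v r).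
Proof.
by move=> Jr x i; rewrite tvE !mxE addrAC subrr add0r -mulrA mulrC; exact: JM.
Qed.

End Cong.

(** It suffices to compare [g h] with [h g], whose difference is
    [(g - 1)(h - 1) - (h - 1)(g - 1)]. *)
Lemma congruence_comm I J K g h : is_ideal I -> is_ideal J -> is_ideal K ->
  (forall a b, I a -> J b -> K (a * b)) ->
  congruence_subgroup I g -> congruence_subgroup J h ->
  congruence_subgroup K [~ g, h]%g.
Proof.
move=> iI iJ iK IJK Gg Gh.
(* Expanding [y] in the standard basis, [(g' - 1) y] has coordinates that are sums of products from
   [I'] and [J']. *)
have diff (g' : Sp4 R) I' J' : (forall a b, I' a -> J' b -> K (a * b)) ->
    congruence_subgroup I' g' -> forall y, (forall i, J' (y i 0)) ->
    congv K (act g' y) y.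
  move=> IJK' Gg' y Jy i.
  have -> : act g' y i 0 - y i 0 =
      \sum_j (act g' (delta_mx j 0) i 0 - (delta_mx j 0 : 'cV_4) i 0) * y j 0.
    rewrite {1}/act mxE; under [RHS]eq_bigr do rewrite mulrBl /act -colE mxE.
    rewrite sumrB; congr (_ - _); rewrite (bigD1 i) //= big1 ?addr0.
      by rewrite mxE !eqxx mul1r.
    by move=> j ji; rewrite mxE eq_sym (negPf ji) mul0r.
  have [K0 KD _] := iK; elim/big_ind: _ => // j _.
  by apply: IJK' => //; exact: Gg'.
move=> x; rewrite /commg !actM.
rewrite -[X in congv K _ X](actVK g); apply: congv_act => //.
rewrite -[X in congv K _ X](actVK h); apply: congv_act => //.
set gx := act g x; have hgx := Gh gx.
have -> : act g (act h x) = act h gx +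
    ((act g (act h x - x) - (act h x - x)) - (act h (gx - x) - (gx - x))).
  by rewrite !actB /gx; apply: cV4P; rewrite !mxE; ring.
have cB y y' i : (y - y') i 0 = y i 0 - y' i 0 by rewrite !mxE.
move=> i; rewrite mxE addrAC subrr add0r cB; apply: (idealB iK).
  have Jd j : J ((act h x - x) j 0) by rewrite cB; exact: Gh.
  by have := diff g I J IJK Gg _ Jd i; rewrite !cB.
have Id j : I ((gx - x) j 0) by rewrite cB; exact: Gg.
have IJK' a b : J a -> I b -> K (a * b) by rewrite mulrC => Ja Ib; exact: IJK.
by have := diff h J I IJK' Gh _ Id i; rewrite !cB.
Qed.

End Congruence.

(** * Reduction of congruence subgroups *)

(* Says that [R / a R] is zero-dimensional for every nonzero [a]. *)
Definition pi_regular_quotients (R : comNzRingType) := forall a b : R, a != 0 ->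
  exists k w q, b ^+ k * (1 - b * w) = a * q.

Section Reduction.
Variable R : comNzRingType.
Implicit Types (a b c d p q r s t u : R) (v w x y z : 'cV[R]_4) (g h : Sp4 R).
Implicit Types (I J : set R) (N : set (Sp4 R)).

Local Notation e1 := (e1 R).
Local Notation e2 := (e2 R).
Local Notation f1 := (f1 R).
Local Notation f2 := (f2 R).

(* With [t = 1 - x w], where [x^k (1 - x w)] is divisible by [u], the element [x]
   is both nilpotent and a unit modulo [x + t y] and [u]. *)
Lemma stable_range1 (u x y c d : R) : pi_regular_quotients R -> u != 0 ->
  x * c + y + u * d = 1 -> exists t A B, A * (x + t * y) + B * u = 1.
Proof.
move=> piR u0 xyu; have [k [w [q xk]]] := piR u x u0.
pose t := 1 - x * w; pose z := x + t * y.
pose e := 1 - w - c + x * w * c.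
have zE : z = 1 + x * e - u * (t * d).
  have yE : y = 1 - x * c - u * d by rewrite -xyu; ring.
  by rewrite /z yE /t /e; ring.
have xk1 : x ^+ k.+1 = x ^+ k * z - u * (q * y).
  by rewrite mulrA -xk /z /t exprS; ring.
pose S := \sum_(i < k.+1) (- (x * e)) ^+ i.
have geo : 1 - (- (x * e)) ^+ k.+1 = (1 + x * e) * S.
  by rewrite -[1 in LHS](expr1n _ k.+1) subrXX opprK; congr (_ * _);
     apply: eq_bigr => i _; rewrite expr1n mul1r.
exists t, (S + (- e) ^+ k.+1 * x ^+ k), (t * d * S - (- e) ^+ k.+1 * (q * y)).
rewrite -/z.
have -> : 1 = (1 + x * e) * S + (- e) ^+ k.+1 * x ^+ k.+1.
  by rewrite -geo -exprMn mulNr (mulrC e) subrK.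
have -> : 1 + x * e = z + u * (t * d) by rewrite zE subrK.
by rewrite xk1; ring.
Qed.

Lemma omega_e1 z : omega z e1 = - z i2 0.
Proof. by rewrite /omega !mxE /=; ring. Qed.
Lemma omega_e2 z : omega z e2 = - z i3 0.
Proof. by rewrite /omega !mxE /=; ring. Qed.
Lemma omega_f1 z : omega z f1 = z i0 0.
Proof. by rewrite /omega !mxE /=; ring. Qed.
Lemma omega_f2 z : omega z f2 = z i1 0.
Proof. by rewrite /omega !mxE /=; ring. Qed.

Lemma omega_e1l z : omega e1 z = z i2 0. Proof. by rewrite omegaC omega_e1 opprK. Qed.
Lemma omega_e2l z : omega e2 z = z i3 0. Proof. by rewrite omegaC omega_e2 opprK. Qed.
Lemma omega_f1l z : omega f1 z = - z i0 0. Proof. by rewrite omegaC omega_f1. Qed.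
Lemma omega_f2l z : omega f2 z = - z i1 0. Proof. by rewrite omegaC omega_f2. Qed.

Lemma mv_e1e2E r z : act (mv e1 e2 r) z =
  vec4 (z i0 0 + r * z i3 0) (z i1 0 + r * z i2 0) (z i2 0) (z i3 0).
Proof. by rewrite mvE; [apply: cV4P|]; rewrite /omega !mxE /=; ring. Qed.
Lemma mv_e1f2E r z : act (mv e1 f2 r) z =
  vec4 (z i0 0 - r * z i1 0) (z i1 0) (z i2 0) (z i3 0 + r * z i2 0).
Proof. by rewrite mvE; [apply: cV4P|]; rewrite /omega !mxE /=; ring. Qed.
Lemma mv_f1e2E r z : act (mv f1 e2 r) z =
  vec4 (z i0 0) (z i1 0 - r * z i0 0) (z i2 0 + r * z i3 0) (z i3 0).
Proof. by rewrite mvE; [apply: cV4P|]; rewrite /omega !mxE /=; ring. Qed.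
Lemma mv_f1f2E r z : act (mv f1 f2 r) z =
  vec4 (z i0 0) (z i1 0) (z i2 0 - r * z i1 0) (z i3 0 - r * z i0 0).
Proof. by rewrite mvE; [apply: cV4P|]; rewrite /omega !mxE /=; ring. Qed.
Lemma tv_e1E r z : act (tv e1 r) z = vec4 (z i0 0 + r * z i2 0) (z i1 0) (z i2 0) (z i3 0).
Proof. by rewrite tvE; apply: cV4P; rewrite /omega !mxE /=; ring. Qed.
Lemma tv_f1E r z : act (tv f1 r) z = vec4 (z i0 0) (z i1 0) (z i2 0 - r * z i0 0) (z i3 0).
Proof. by rewrite tvE; apply: cV4P; rewrite /omega !mxE /=; ring. Qed.

Lemma swap_e1 : act (swap R) e1 = e2. Proof. by rewrite swapE; apply: cV4P; rewrite !mxE. Qed.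
Lemma swap_e2 : act (swap R) e2 = e1. Proof. by rewrite swapE; apply: cV4P; rewrite !mxE. Qed.
Lemma swap_f1 : act (swap R) f1 = f2. Proof. by rewrite swapE; apply: cV4P; rewrite !mxE. Qed.
Lemma swap_f2 : act (swap R) f2 = f1. Proof. by rewrite swapE; apply: cV4P; rewrite !mxE. Qed.

(** A level known at [e1] transfers to the whole orbit; the orbit lemmas below make it available for
    the factors of the elements [mv]. *)
Definition e1_orbit v := exists g, v = act g e1.

Lemma orbit_act g v : e1_orbit v -> e1_orbit (act g v).
Proof. by move=> [h ->]; exists (g * h)%g; rewrite actM. Qed.

Lemma orbit_e1 : e1_orbit e1. Proof. by exists 1%g; rewrite act1. Qed.

Fact rot_det : 0 * 0 - (-1) * 1 = 1 :> R. Proof. by ring. Qed.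

Lemma orbit_f1 : e1_orbit f1.
Proof. by exists (emb rot_det); rewrite embE; apply: cV4P; rewrite !mxE /=; ring. Qed.

Lemma orbit_e2 : e1_orbit e2. Proof. by exists (swap R); rewrite swap_e1. Qed.

Lemma orbit_f2 : e1_orbit f2.
Proof. by rewrite -swap_f1; apply: orbit_act; exact: orbit_f1. Qed.

Lemma orbit_e1e2 : e1_orbit (e1 + e2).
Proof. by exists (mv f1 e2 (-1)); rewrite mv_f1e2E; apply: cV4P; rewrite !mxE /=; ring. Qed.

Lemma orbit_e1f1 : e1_orbit (e1 + f1).
Proof. by exists (tv f1 (-1)); rewrite tv_f1E; apply: cV4P; rewrite !mxE /=; ring. Qed.

Lemma orbit_e1f2 : e1_orbit (e1 + f2).
Proof. by exists (mv f1 f2 (-1)); rewrite mv_f1f2E; apply: cV4P; rewrite !mxE /=; ring. Qed.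

Lemma orbit_f1e2 : e1_orbit (f1 + e2).
Proof.
suff -> : f1 + e2 = act (emb rot_det) (e1 + e2) by apply: orbit_act; exact: orbit_e1e2.
by rewrite embE; apply: cV4P; rewrite !mxE /=; ring.
Qed.

Lemma orbit_f1f2 : e1_orbit (f1 + f2).
Proof.
suff -> : f1 + f2 = act (emb rot_det) (e1 + f2) by apply: orbit_act; exact: orbit_e1f2.
by rewrite embE; apply: cV4P; rewrite !mxE /=; ring.
Qed.

#[local] Hint Resolve orbit_e1 orbit_e2 orbit_f1 orbit_f2 : core.
#[local] Hint Resolve orbit_e1e2 orbit_e1f2 orbit_f1e2 orbit_f1f2 : core.

Definition level_ge N v c := forall r, N (tv v (c * r)).

Section Level.
Variables (N : set (Sp4 R)) (c : R).
Hypothesis nN : normal_subgroup N.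

Lemma level_ge_act g v : level_ge N v c -> level_ge N (act g v) c.
Proof. by move=> Nv r; have := nN.2 _ g^-1%g (Nv r); rewrite tvJ invgK. Qed.

Hypothesis Ne1 : level_ge N e1 c.

Lemma level_ge_orbit v : e1_orbit v -> level_ge N v c.
Proof. by move=> [g ->]; exact: level_ge_act. Qed.

Let G_c := congruence_subgroup (principal c).
Let ic := principal_ideal c.
Let sG : subgroup G_c := (congruence_normal ic).1.
Let sN : subgroup N := nN.1.
(** Multiplying by elements of [L] stays inside [G_c] and preserves the class modulo [N]. *)
Let L : set (Sp4 R) := N `&` G_c.

Lemma principalM r : principal c (c * r). Proof. by exists r. Qed.

Lemma L_mul g h : L g -> L h -> L (g * h)%g.
Proof. by move=> [? ?] [? ?]; split; [exact: (subgroupM sN)|exact: (subgroupM sG)]. Qed.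

Lemma tv_L v r : e1_orbit v -> L (tv v (c * r)).
Proof.
move=> ov; split; first exact: level_ge_orbit.
by apply: (tv_congruence ic); exact: principalM.
Qed.

Lemma mv_L x y r : e1_orbit x -> e1_orbit y -> e1_orbit (x + y) -> L (mv x y (c * r)).
Proof. by move=> ox oy oxy; rewrite /mv -mulrN; do 2?[apply: L_mul]; exact: tv_L. Qed.

Definition X_c : set (Sp4 R) := [set g | [/\ G_c g, act g e2 = e2 & act g f2 = f2]].
Definition Y_c : set (Sp4 R) := [set g | [/\ G_c g, act g e1 = e1 & act g f1 = f1]].

Lemma fix_V g x : act g x = x -> act g^-1%g x = x.
Proof. by move=> {1}<-; rewrite actVK. Qed.

Lemma X_c_subgroup : subgroup X_c.
Proof.
split; first by split; rewrite ?act1 //; case: sG.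
move=> g h [Gg ge gf] [Gh he hf]; split; first exact: sG.2.
  by rewrite actM (fix_V he).
by rewrite actM (fix_V hf).
Qed.

Lemma Y_c_subgroup : subgroup Y_c.
Proof.
split; first by split; rewrite ?act1 //; case: sG.
move=> g h [Gg ge gf] [Gh he hf]; split; first exact: sG.2.
  by rewrite actM (fix_V he).
by rewrite actM (fix_V hf).
Qed.

Lemma swapV : ((swap R)^-1 = swap R)%g.
Proof.
apply: mulg1_eq; apply: Sp4_ext => x.
by rewrite actM !swapE act1; apply: cV4P; rewrite !mxE.
Qed.

Lemma X_c_swap g : X_c g -> Y_c (g ^ swap R)%g.
Proof.
move=> [Gg ge gf]; split; first exact: (congruence_normal ic).2.
  by rewrite conjgE !actM swapV swap_e1 ge swap_e2.
by rewrite conjgE !actM swapV swap_f1 gf swap_f2.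
Qed.

Lemma Y_c_swap g : Y_c g -> X_c (g ^ swap R)%g.
Proof.
move=> [Gg ge gf]; split; first exact: (congruence_normal ic).2.
  by rewrite conjgE !actM swapV swap_e2 ge swap_e1.
by rewrite conjgE !actM swapV swap_f2 gf swap_f1.
Qed.

(** Each element preserves the orthogonal complement of the plane it fixes, and that complement is
    the plane fixed by the other. *)
Lemma X_c_Y_c_commute g h : X_c g -> Y_c h -> commute g h.
Proof.
move=> [_ ge2 gf2] [_ he1 hf1].
have gplane x : x i1 0 = 0 -> x i3 0 = 0 ->
    act g x i1 0 = 0 /\ act g x i3 0 = 0.
  move=> x1 x3; split; first by rewrite -omega_f2 -gf2 omega_act omega_f2.
  by rewrite -[LHS]opprK -omega_e2 -ge2 omega_act omega_e2 x3 !oppr0.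
have hplane x : x i0 0 = 0 -> x i2 0 = 0 ->
    act h x i0 0 = 0 /\ act h x i2 0 = 0.
  move=> x0 x2; split; first by rewrite -omega_f1 -hf1 omega_act omega_f1.
  by rewrite -[LHS]opprK -omega_e1 -he1 omega_act omega_e1 x2 !oppr0.
have hfix x : x i1 0 = 0 -> x i3 0 = 0 -> act h x = x.
  move=> x1 x3; rewrite [x in LHS]cV4_basis [RHS]cV4_basis x1 x3 !scale0r !addr0.
  by rewrite actD !actZ he1 hf1.
have gfix x : x i0 0 = 0 -> x i2 0 = 0 -> act g x = x.
  move=> x0 x2; rewrite [x in LHS]cV4_basis [RHS]cV4_basis x0 x2 !scale0r !addr0 !add0r.
  by rewrite actD !actZ ge2 gf2.
apply: Sp4_ext => x; rewrite !actM.
have -> : x = vec4 (x i0 0) 0 (x i2 0) 0 + vec4 0 (x i1 0) 0 (x i3 0).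
  by apply: cV4P; rewrite !mxE /=; ring.
set a := vec4 _ _ _ _; set b := vec4 _ _ _ _.
rewrite !actD (hfix a) ?(gfix b) ?mxE //.
have [a1 a3] : act g a i1 0 = 0 /\ act g a i3 0 = 0 by apply: gplane; rewrite mxE.
have [b0 b2] : act h b i0 0 = 0 /\ act h b i2 0 = 0 by apply: hplane; rewrite mxE.
by rewrite (gfix (act h b)) // (hfix (act g a)).
Qed.


Hypothesis piR : pi_regular_quotients R.

Lemma L1 : L 1%g. Proof. by split; [case: sN|case: sG]. Qed.

Lemma G_c_entry g x i : G_c g -> exists a, act g x i 0 = x i 0 + c * a.
Proof. by move=> /(_ x i) [a E]; exists a; rewrite -E addrC subrK. Qed.

(** Prepares for [stable_range1], which requires a nonzero modulus. A zero corner makes [c] a unit,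
    so [L] contains [tv v 1] for [v] among [e1], [e1 + e2], [e1 + f2]; if none of these helped, the
    whole column would vanish. *)
Lemma nonzero_corner g : G_c g -> exists2 n, L n & act (n * g)%g e1 i0 0 != 0.
Proof.
move=> Gg; have [u0|?] := eqVneq (act g e1 i0 0) 0; last first.
  by exists 1%g; [exact: L1|rewrite mul1g].
have [a] := G_c_entry e1 i0 Gg; rewrite u0 mxE /= => ca.
have {}ca : c * a = -1 by apply/eqP; rewrite -subr_eq0 opprK addrC -ca.
have all_G h : G_c h.
  move=> x i; exists (- a * (act h x i 0 - x i 0)).
  by rewrite mulrA mulrN ca opprK mul1r.
have all_L v : level_ge N v c -> L (tv v 1).
  by move=> /(_ (- a)); rewrite mulrN ca opprK => Nv; split.
have corner v : act (tv v 1) (act g e1) i0 0 = omega v (act g e1) * v i0 0.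
  by rewrite tvE mxE u0 add0r mul1r mxE.
suff [v [Nv v0 om]] : exists v, [/\ level_ge N v c, v i0 0 = 1 & omega v (act g e1) != 0].
  by exists (tv v 1); [exact: all_L|rewrite actM corner v0 mulr1].
have := omega_act g e1 f1; rewrite omega_f1 [X in _ = X]mxE /=.
move: (act g e1) (act g f1) u0 => x y x0 xy.
have [x2|x2] := eqVneq (omega e1 x) 0; last by exists e1; split; rewrite ?mxE.
have [x3|x3] := eqVneq (omega (e1 + e2) x) 0; last first.
  by exists (e1 + e2); split; rewrite ?mxE /= ?addr0 //; exact: level_ge_orbit.
have [x1|x1] := eqVneq (omega (e1 + f2) x) 0; last first.
  by exists (e1 + f2); split; rewrite ?mxE /= ?mxE /= ?addr0 //; exact: level_ge_orbit.
suff : (1 : R) == 0 by rewrite oner_eq0.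
rewrite -xy /omega x0; move: x2 x3 x1; rewrite /omega !mxE /= => x2 x3 x1.
have {}x2 : x i2 0 = 0 by rewrite -x2; ring.
have {}x3 : x i3 0 = 0 by rewrite -x3 x2; ring.
have {}x1 : x i1 0 = 0 by apply: oppr_inj; rewrite oppr0 -x1 x2; ring.
by rewrite x1 x2 x3; apply/eqP; ring.
Qed.


Lemma G_c_e1 g : G_c g -> exists a0 a1 a2 a3,
  act g e1 = vec4 (1 + c * a0) (c * a1) (c * a2) (c * a3).
Proof.
move=> Gg; have [a0 v0] := G_c_entry e1 i0 Gg; have [a1 v1] := G_c_entry e1 i1 Gg.
have [a2 v2] := G_c_entry e1 i2 Gg; have [a3 v3] := G_c_entry e1 i3 Gg.
exists a0, a1, a2, a3.
by apply: cV4P; rewrite ?(v0, v1, v2, v3) !mxE /= ?add0r.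
Qed.

Lemma G_c_f1 g : G_c g -> exists a0 a1 a2 a3,
  act g f1 = vec4 (c * a0) (c * a1) (1 + c * a2) (c * a3).
Proof.
move=> Gg; have [a0 v0] := G_c_entry f1 i0 Gg; have [a1 v1] := G_c_entry f1 i1 Gg.
have [a2 v2] := G_c_entry f1 i2 Gg; have [a3 v3] := G_c_entry f1 i3 Gg.
exists a0, a1, a2, a3.
by apply: cV4P; rewrite ?(v0, v1, v2, v3) !mxE /= ?add0r.
Qed.

(* After making the third entry of the first column comaximal with the first, a
   rotation [x] in the plane of [e1] and [f1] brings the first entry to [1]. *)
Lemma rotate_column g : G_c g -> exists n (x : Sp4 R), [/\ L n, X_c x &
  exists a b, act (x^-1 * (n * g))%g e1 = vec4 1 (c * a) 0 (c * b)].
Proof.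
move=> Gg0; have [n0 Ln0 u0] := nonzero_corner Gg0.
pose g' := (n0 * g)%g.
have Gg : G_c g' by apply: (subgroupM sG) => //; case: Ln0.
have [a0 [a1 [a2 [a3 vE]]]] := G_c_e1 Gg.
have := omega_act g' e1 f1; rewrite omega_f1 [X in _ = X]mxE /= vE.
rewrite actM -actM vE mxE /= in u0.
set u := 1 + c * a0 in u0 vE *; have ua : u = 1 + c * a0 by []; clearbody u.
move: (act g' f1) => y.
set y0 := y i0 0; set y1 := y i1 0; set y2 := y i2 0; set y3 := y i3 0.
rewrite /omega !mxE /= -/y0 -/y1 -/y2 -/y3.
move=> vy.
(* The pairing of the images of [e1] and [f1], arranged as a comaximality relation for the third
   entry divided by [c]. *)
have vy' : a2 * (- c * y0) + (a1 * (c * y3) + a3 * (- c * y1)) + u * y2 = 1.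
  by rewrite -vy; ring.
have [t [A [B AB]]] := stable_range1 piR u0 vy'.
(* The parameters [tau] and [sg] are read off from [z]: [n2 * n1] turns the third entry into [m],
   which is [c * z] up to a multiple of [u]. *)
pose z := a2 + t * (a1 * (c * y3) + a3 * (- c * y1)).
pose tau := t * y3; pose sg := - (t * y1).
pose n1 := mv f1 f2 (c * - tau); pose n2 := mv f1 e2 (c * sg).
(* Modulo [u] one has [A * z = 1] and [c * a0 = -1], so [- (c * r) * m] is
   [c ^+ 2 * a0 ^+ 2 * (A * z) = 1]. The factor [a0 ^+ 2] thus inverts [m] while the upper right
   entry [c * r] stays in [c R]. *)
pose r := - (A * a0 ^+ 2).
pose m := c * z + (c * sg) * (c * tau) * u.
pose s := - ((u - 2) * (1 - B * u) - B + (c * sg) * (c * tau) * c * A * a0 ^+ 2).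
have v'E : act (n2 * n1 * g')%g e1 = vec4 u (c * (a1 - sg * u)) m (c * (a3 + tau * u)).
  rewrite actM vE actM [act n1 _]mv_f1f2E [act n2 _]mv_f1e2E.
  apply: cV4P; rewrite !mxE /= ?mxE /=.
  - by [].
  - by ring.
  - by rewrite /m /z /tau /sg; ring.
  - by ring.
have det : u * s - (c * r) * m = 1.
  have AzE : A * z = 1 - B * u by rewrite -AB addrK.
  transitivity (u * s + c ^+ 2 * a0 ^+ 2 * (A * z) +
    c * A * a0 ^+ 2 * ((c * sg) * (c * tau) * u)).
    by rewrite /m /r; ring.
  rewrite AzE (_ : c ^+ 2 * a0 ^+ 2 = (u - 1) ^+ 2); last by rewrite ua; ring.
  by rewrite /s; ring.
pose x := emb det.
exists (n2 * n1 * n0)%g, x; split.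
- by apply: L_mul => //; apply: L_mul; apply: mv_L.
- split; last 2 first.
    by rewrite embE; apply: cV4P; rewrite !mxE /=; ring.
    by rewrite embE; apply: cV4P; rewrite !mxE /=; ring.
  move=> w; rewrite embE; elim/ord4P; rewrite mxE /=.
  + by exists (a0 * w i0 0 + r * w i2 0); rewrite ua; ring.
  + by exists 0; ring.
  (* Replacing [1] by the determinant gives [s - 1 = c * (r * m - a0 * s)]. *)
  + by exists ((z + sg * (c * tau) * u) * w i0 0 + (r * m - a0 * s) * w i2 0);
       rewrite -[X in _ - X]mul1r -[X in _ - X * _]det;
       rewrite [X in _ - (X * _ - _) * _]ua /m; ring.
  + by exists 0; ring.
exists (a1 - sg * u), (a3 + tau * u).
rewrite actM -mulgA v'E.
have -> : vec4 u (c * (a1 - sg * u)) m (c * (a3 + tau * u)) =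
    act x (vec4 1 (c * (a1 - sg * u)) 0 (c * (a3 + tau * u))).
  by rewrite embE; apply: cV4P; rewrite !mxE /=; ring.
by rewrite actVK.
Qed.

Lemma clear_column g a b : act g e1 = vec4 1 (c * a) 0 (c * b) ->
  exists2 n, L n & act (n * g)%g e1 = e1.
Proof.
(* Clearing the second entry with [mv f1 e2] creates [c * a * (c * b)] in the third, which the outer
   [tv f1] removes. *)
move=> gE; exists (tv f1 (c * (a * (c * b))) * (mv f1 f2 (c * b) * mv f1 e2 (c * a)))%g.
  by do 2?[apply: L_mul]; [apply: tv_L|apply: mv_L|apply: mv_L].
rewrite actM gE [act (_ * _)%g _]actM [act (_ * _)%g _]actM mv_f1e2E mv_f1f2E tv_f1E.
by apply: cV4P; rewrite !mxE /= ?mxE /= ?mxE /= ?mxE /=; ring.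
Qed.

(** Since [h] fixes [e1], its image of [f1] has third entry [1]; root elements fixing [e1] then
    bring that image back to [f1]. *)
Lemma clear_row h : G_c h -> act h e1 = e1 ->
  exists2 n, L n & Y_c (n * h)%g.
Proof.
move=> Gh he.
have [a0 [a1 [a2 [a3 vE]]]] := G_c_f1 Gh.
have v2 : 1 + c * a2 = 1.
  have := omega_act h e1 f1; rewrite he vE /omega !mxE /= => v2.
  by apply: etrans (etrans v2 _); ring.
rewrite {}v2 in vE.
pose n1 := mv e1 e2 (c * - a1); pose n2 := mv e1 f2 (c * - a3).
pose n3 := tv e1 (c * - (a0 - a1 * (c * a3))).
have Ln : L (n3 * (n2 * n1))%g.
  by do 2?[apply: L_mul]; [apply: tv_L|apply: mv_L|apply: mv_L].
exists (n3 * (n2 * n1))%g => //; split.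
- by apply: (subgroupM sG) => //; case: Ln.
- rewrite actM he (actM n3) (actM n2).
  rewrite [act n1 _]mv_e1e2E [act n2 _]mv_e1f2E [act n3 _]tv_e1E.
  by apply: cV4P; rewrite !mxE /= ?mxE /= ?mxE /= ?mxE /=; ring.
- rewrite actM vE (actM n3) (actM n2).
  rewrite [act n1 _]mv_e1e2E [act n2 _]mv_e1f2E [act n3 _]tv_e1E.
  by apply: cV4P; rewrite !mxE /= ?mxE /= ?mxE /= ?mxE /=; ring.
Qed.

Lemma congruence_decomposition g : G_c g ->
  exists n (x y : Sp4 R), [/\ N n, X_c x, Y_c y & g = (n * x * y)%g].
Proof.
move=> Gg; have [n [x [Ln Xx [a [b col]]]]] := rotate_column Gg.
have [n' Ln' col'] := clear_column col.
have Gh : G_c (n' * (x^-1 * (n * g)))%g.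
  apply: (subgroupM sG); first by case: Ln'.
  apply: (subgroupM sG); first by apply: (subgroupV sG); case: Xx.
  by apply: (subgroupM sG) => //; case: Ln.
have [n'' Ln'' Yy] := clear_row Gh col'.
have [Nn _] := Ln; have [Nn' _] := Ln'; have [Nn'' _] := Ln''.
exists (n^-1 * (n'^-1 * n''^-1) ^ x^-1)%g, x, (n'' * (n' * (x^-1 * (n * g))))%g.
split=> //.
  apply: (subgroupM sN); first exact: subgroupV.
  by apply: nN.2; apply: (subgroupM sN); exact: subgroupV.
by rewrite conjgE invgK !mulgA !mulgVK mulgK mulVg mul1g.
Qed.

Lemma commutator_sub_of_congruence :
  (forall g, prodset N G_c g) -> forall g h, N [~ g, h]%g.
Proof.
move=> NG; apply: (@commutator_sub_of_swap _ N nN X_c Y_c (swap R)).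
- exact: X_c_subgroup.
- exact: Y_c_subgroup.
- exact: X_c_Y_c_commute.
- exact: X_c_swap.
- exact: Y_c_swap.
move=> g; have [n [h [Nn Gh ->]]] := NG g.
have [n' [x [y [Nn' Xx Yy ->]]]] := congruence_decomposition Gh.
by exists (n * n')%g, x, y; split; rewrite ?mulgA //; exact: (subgroupM sN).
Qed.

End Level.
End Reduction.

(** * Transvections equal modulo a normal subgroup *)

(** Reduces membership in an ideal to a ring identity. *)
Lemma set_mem_eq (V : Type) (A : set V) a b : a = b -> A a -> A b.
Proof. by move->. Qed.

Section Link.
Variable R : comNzRingType.
Implicit Types (a b c d p q r s t : R) (u v w x y z : 'cV[R]_4) (g h : Sp4 R).
Implicit Types (I J : set R) (N : set (Sp4 R)).

Local Notation e1 := (e1 R).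
Local Notation e2 := (e2 R).
Local Notation f1 := (f1 R).
Local Notation f2 := (f2 R).

Definition link N x y := forall r, eqmod N (tv x r) (tv y r).

(* Polarization of [v |-> v^2] on the isotropic plane spanned by [w] and [d]. *)
Lemma tv_polarization w (d : 'cV_4) r : omega w d = 0 ->
  (tv (w + d) r * tv (w - d) r * tv w (- (2 * r)))%g = tv d (2 * r).
Proof.
move=> wd; have dw : omega d w = 0 by rewrite omegaC wd oppr0.
apply: Sp4_ext => x; rewrite !actM !tvE.
rewrite !(omegaDl, omegaDr, omegaNl, omegaNr, omegaZr, omegaxx, wd, dw).
by apply: cV4P; rewrite !mxE; ring.
Qed.

Section Normal.
Variable N : set (Sp4 R).
Hypothesis nN : normal_subgroup N.

Lemma link_sym x y : link N x y -> link N y x.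
Proof. by move=> xy r; exact: eqmod_sym. Qed.

Lemma link_trans y x z : link N x y -> link N y z -> link N x z.
Proof. by move=> xy yz r; exact: eqmod_trans (xy r) (yz r). Qed.

Lemma link_act g x y : link N x y -> link N (act g x) (act g y).
Proof.
move=> xy r; have := eqmodJ nN (xy r) (eqmod_refl nN g^-1%g).
by rewrite !tvJ invgK.
Qed.

Lemma link_mem g x : N g -> link N x (act g x).
Proof.
move=> Ng r; rewrite -[g]invgK -tvJ -[X in eqmod _ X _](conjg1 (tv x r)).
apply: eqmodJ => //; first exact: eqmod_refl.
by rewrite /eqmod div1g invgK.
Qed.

Lemma linkZ a x y : link N x y -> link N (a *: x) (a *: y).
Proof. by move=> xy r; rewrite !tvZ; exact: xy. Qed.

Lemma link_cong J x y : is_ideal J -> congruence_subgroup J `<=` N ->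
  congv J x y -> link N x y.
Proof. by move=> iJ JN xy r; apply: JN; exact: tv_cong. Qed.

(** The transvection [tv z s] fixes [w], so it carries the link from [w] to [v] into a link from [w]
    to the moved [v]. *)
Lemma link_move s z v w : link N w v -> omega z w = 0 ->
  link N v (v + (s * omega z v) *: z).
Proof.
move=> wv zw; rewrite -tvE; apply: (link_trans (link_sym wv)).
have := link_act (tv z s) wv.
by rewrite tvE zw mulr0 scale0r addr0.
Qed.

(** Modulo [N] every factor of the polarization identity is a transvection along [w], and the
    parameters [r], [r], [- (2 * r)] cancel. *)
Lemma tv_of_links w (d : 'cV_4) :
  omega w d = 0 -> link N w (w + d) -> link N w (w - d) ->
  forall r, N (tv d (2 * r)).
Proof.
move=> wd wD wB r; apply: eqmod1.
rewrite -(tv_polarization r wd) tvN mulrDl mul1r tvD.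
have := eqmodM nN (eqmodM nN (eqmod_sym nN (wD r)) (eqmod_sym nN (wB r)))
  (eqmod_refl nN (tv w r * tv w r)^-1%g).
by rewrite mulgV.
Qed.

(* The vectors [w + omega(z, w) z], for [z] orthogonal to [e1], are all linked to
   [w]; taking [z] to be [e1] and [e1 +- z1] gives three of them in arithmetic
   progression. *)
Lemma level_of_link w : link N e1 w -> level_ge N e1 (4 * omega e1 w ^+ 4).
Proof.
move=> ew; set b := omega e1 w.
have bE : b = w i2 0 by rewrite /b omegaC omega_e1 opprK.
(* Orthogonal to both [e1] and [w], so [e1], [e1 + z1] and [e1 - z1] all pair with [w] to [b]. *)
pose z1 := b *: e2 - w i3 0 *: e1.
have ze : omega z1 e1 = 0 by rewrite omega_e1 !mxE /=; ring.
have zw : omega z1 w = 0 by rewrite /omega !mxE /= -bE; ring.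
have w0z : omega (w + b *: e1) (b *: z1) = 0.
  by rewrite omegaC omegaZl omegaDr omegaZr ze zw; ring.
have lw z : omega z e1 = 0 -> omega z w = b -> link N w (w + b *: z).
  by move=> ze1 zwb; have := link_move 1 ew ze1; rewrite mul1r zwb.
have lw0 : link N w (w + b *: e1) by apply: lw => //; exact: omegaxx.
have z1N : level_ge N z1 (2 * b ^+ 2).
  move=> r; rewrite -mulrA mulrCA -tvZ.
  apply: (tv_of_links w0z); apply: (link_trans (link_sym lw0)).
    rewrite -addrA -scalerDr; apply: lw.
      by rewrite omegaDl omegaxx ze addr0.
    by rewrite omegaDl zw addr0.
  rewrite -addrA -scalerBr; apply: lw.
    by rewrite omegaDl omegaNl omegaxx ze subr0.
  by rewrite omegaDl omegaNl zw subr0.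
have zbe : omega z1 (b *: e1) = 0 by rewrite omegaZr ze mulr0.
(* A second polarization, centred at [z1] with difference [b *: e1], passes from [z1] to [e1]. Each
   of the two contributes a factor [2 * b ^+ 2]. *)
have gz s : level_ge N (z1 + (s * b) *: e1) (2 * b ^+ 2).
  suff -> : z1 + (s * b) *: e1 = act (mv e1 f2 (- s)) z1.
    by apply: level_ge_act => //; exact: z1N.
  by rewrite mv_e1f2E; apply: cV4P; rewrite !mxE /=; ring.
move=> r; rewrite (_ : 4 * b ^+ 4 * r = b ^+ 2 * (2 * ((2 * b ^+ 2) * r))); last by ring.
rewrite -tvZ -(tv_polarization _ zbe) -mulrN.
apply: (subgroupM nN.1); last first.
  have E : 2 * - (2 * b ^+ 2 * r) = 2 * b ^+ 2 * - (2 * r) by ring.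
  by rewrite E; exact: z1N.
apply: (subgroupM nN.1).
  by have := gz 1 r; rewrite mul1r.
by have := gz (-1) r; rewrite mulN1r scaleNr.
Qed.

Section Prime.
Variable J : set R.
Hypothesis iJ : is_ideal J.

Definition scalar_mod g := exists a, forall x, congv J (act g x) (a *: x).

(** Otherwise every element of [N] has [e1] as an eigenvector modulo [J]. By conjugation [A] then
    has all orbit vectors as eigenvectors, and comparing on the sums [e1 + v] shows that the
    eigenvalues on the basis agree. *)
Lemma moved_point A : N A -> ~ scalar_mod A ->
  exists2 B, N B & exists2 z, omega z e1 = 0 & ~ J (omega z (act B e1)).
Proof.
move=> NA nsA; apply: contrapT => no; apply: nsA.
have [J0 JD JM] := iJ.
have fixed B : N B -> congv J (act B e1) (act B e1 i0 0 *: e1).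
  move=> NB; have inJ z : omega z e1 = 0 -> J (omega z (act B e1)).
    by move=> ze1; apply: contrapT => nJ; apply: no; exists B => //; exists z.
  elim/ord4P; rewrite [X in _ - X]mxE [X in _ * X]mxE /= ?mulr1 ?mulr0 ?subr0 ?subrr //.
  - rewrite -[X in J X]opprK -omega_f2l; apply: idealN => //.
    by apply: inJ; rewrite omega_e1 mxE oppr0.
  - by rewrite -omega_e1l; apply: inJ; exact: omegaxx.
  - by rewrite -omega_e2l; apply: inJ; rewrite omega_e1 mxE oppr0.
have orb v : e1_orbit v -> exists a, congv J (act A v) (a *: v).
  move=> [g ->]; exists (act (A ^ g)%g e1 i0 0).
  have := congv_act iJ g (fixed _ (nN.2 _ g NA)).
  by rewrite actZ {1}conjgE !actM actKV.
have [a1 H1] := orb _ (orbit_e1 R); exists a1.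
have same v : e1_orbit v -> e1_orbit (e1 + v) -> (exists i, e1 i 0 = 0 /\ v i 0 = 1) ->
    v i0 0 = 0 -> congv J (act A v) (a1 *: v).
  move=> /orb[a Ha] /orb[b Hb] [i [ei vi]] v0.
  have D k : J (a1 * e1 k 0 + a * v k 0 - b * (e1 k 0 + v k 0)).
    have := JD _ _ (Hb k) (idealN iJ (JD _ _ (H1 k) (Ha k))); rewrite actD.
    move: (act A e1) (act A v) => x y; rewrite !mxE => E.
    by apply: (set_mem_eq _ E); ring.
  have ab : J (a - b) by have := D i; rewrite ei vi mulr0 !mulr1 !add0r mulr1.
  have a1b : J (a1 - b) by have := D i0; rewrite v0 mxE /= mulr0 !mulr1 !addr0 mulr1.
  move=> k; rewrite [X in _ - X]mxE.
  rewrite (_ : _ - _ = (act A v k 0 - (a *: v) k 0) +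
    v k 0 * ((a - b) - (a1 - b))); last first.
    by move: (act A v) => y; rewrite mxE; ring.
  by apply: JD => //; apply: JM; exact: idealB.
have H2 : congv J (act A e2) (a1 *: e2).
  apply: same; [exact: (orbit_e2 R)|exact: (orbit_e1e2 R)| |by rewrite mxE].
  by exists i1; rewrite !mxE.
have H3 : congv J (act A f1) (a1 *: f1).
  apply: same; [exact: (orbit_f1 R)|exact: (orbit_e1f1 R)| |by rewrite mxE].
  by exists i2; rewrite !mxE.
have H4 : congv J (act A f2) (a1 *: f2).
  apply: same; [exact: (orbit_f2 R)|exact: (orbit_e1f2 R)| |by rewrite mxE].
  by exists i3; rewrite !mxE.
move=> x k; rewrite {1}(cV4_basis x) !actD !actZ (cV4_basis (a1 *: x)).
move: H1 H2 H3 H4 => /(_ k) + /(_ k) + /(_ k) + /(_ k).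
move: (act A e1) (act A e2) (act A f1) (act A f2) => w1 w2 w3 w4 H1 H2 H3 H4.
have := JD _ _ (JD _ _ (JM (x i0 0) _ H1) (JM (x i1 0) _ H2))
               (JD _ _ (JM (x i2 0) _ H3) (JM (x i3 0) _ H4)).
by move=> E; apply: (set_mem_eq _ E); rewrite !mxE; ring.
Qed.

Hypothesis pJ : forall a b, J (a * b) -> J a \/ J b.

(* If [v] is linked to [e1] and [z] is orthogonal to [e1], then [v] is linked to
   [v + omega(z, v) z], which is not orthogonal to [v] modulo [J]. *)
Lemma link_nonorthogonal A : N A -> ~ scalar_mod A ->
  exists2 w, link N e1 w & ~ J (omega e1 w).
Proof.
move=> NA nsA; have [B NB [z ze1 Jz]] := moved_point NA nsA.
set v := act B e1 in Jz.
have ev : link N e1 v by exact: link_mem.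
have := link_act B^-1%g (link_move 1 ev ze1); rewrite mul1r {1}/v actVK.
set w := act _ _ => ew; exists w => //.
rewrite -(omega_act B) /w actKV -/v omegaDr omegaxx add0r omegaZr (omegaC z v) mulrN.
by move=> /(idealN iJ); rewrite opprK => /pJ[].
Qed.

End Prime.
End Normal.
End Link.

(** * Iwasawa's criterion modulo a maximal ideal *)

Section Maximal.
Variable R : comNzRingType.
Implicit Types (a b c p q r s t : R) (u v w x y z : 'cV[R]_4) (g h : Sp4 R).
Implicit Types (I J : set R) (N : set (Sp4 R)).

Local Notation e1 := (e1 R).
Local Notation e2 := (e2 R).
Local Notation f1 := (f1 R).
Local Notation f2 := (f2 R).

Section Iwasawa.
Variables (N : set (Sp4 R)) (J : set R).
Hypotheses (nN : normal_subgroup N) (iJ : is_ideal J).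
Hypothesis JN : congruence_subgroup J `<=` N.
Hypothesis J1 : ~ J 1.
Hypothesis invJ : forall a, ~ J a -> exists a', J (1 - a * a').
Variable w : 'cV[R]_4.
Hypotheses (e1w : link N e1 w) (Jw : ~ J (omega e1 w)).

Let b := omega e1 w.
Let J0 : J 0. Proof. by case: iJ. Qed.
Let JD c d : J c -> J d -> J (c + d). Proof. by case: iJ => _ + _; exact. Qed.
Let JM c d : J d -> J (c * d). Proof. by case: iJ => _ _; exact. Qed.

(** Root elements fixing [e1] preserve its link to [w] and, as [b] is invertible modulo [J], move
    [w] to [v] modulo [J]. *)
Lemma link_e1 v : J (omega e1 v - b) -> link N e1 v.
Proof.
have bE : b = w i2 0 by exact: omega_e1l.
rewrite omega_e1l => Jv; have [b' Jb] := invJ Jw; rewrite -/b in Jb.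
pose h1 := mv e1 e2 (b' * (v i1 0 - w i1 0)).
pose h2 := mv e1 f2 (b' * (v i3 0 - w i3 0)).
pose x := act h2 (act h1 w).
pose h3 := tv e1 (b' * (v i0 0 - x i0 0)).
have xE : x = vec4 (x i0 0) (w i1 0 + b' * (v i1 0 - w i1 0) * b) b
    (w i3 0 + b' * (v i3 0 - w i3 0) * b).
  rewrite [in RHS]/x bE; apply: cV4P; first by rewrite [RHS]mxE.
  - by rewrite /x [act h2 _]mv_e1f2E [act h1 _]mv_e1e2E !mxE.
  - by rewrite /x [act h2 _]mv_e1f2E [act h1 _]mv_e1e2E !mxE.
  - by rewrite /x [act h2 _]mv_e1f2E [act h1 _]mv_e1e2E !mxE.
have h1e : act h1 e1 = e1.
  by rewrite [act h1 _]mv_e1e2E; apply: cV4P; rewrite !mxE /=; ring.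
have h2e : act h2 e1 = e1.
  by rewrite [act h2 _]mv_e1f2E; apply: cV4P; rewrite !mxE /=; ring.
have h3e : act h3 e1 = e1.
  by rewrite [act h3 _]tv_e1E; apply: cV4P; rewrite !mxE /=; ring.
have ew' : link N e1 (act h3 x).
  by have := link_act nN h3 (link_act nN h2 (link_act nN h1 e1w)); rewrite h1e h2e h3e.
apply: (link_trans nN ew'); apply: (link_cong iJ JN).
have close s : J (b' * s * b - s).
  by apply: (set_mem_eq _ (JM (- s) Jb)); ring.
rewrite [act h3 x]tv_e1E.
move: (close (v i0 0 - x i0 0)); move: xE; set x0 := x i0 0; move=> -> c0.
elim/ord4P; rewrite !mxE /=.
- by apply: (set_mem_eq _ c0); ring.
- by apply: (set_mem_eq _ (close (v i1 0 - w i1 0))); ring.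
- by rewrite -opprB; exact: idealN.
- by apply: (set_mem_eq _ (close (v i3 0 - w i3 0))); ring.
Qed.

Lemma link_orbit e v v' :
  e1_orbit e -> J (omega e v - b) -> J (omega e v' - b) -> link N v v'.
Proof.
move=> [g ->]; rewrite -(omega_act g^-1%g _ v) -(omega_act g^-1%g _ v') actVK => Jv Jv'.
rewrite -(actKV g v) -(actKV g v'); apply: (link_act nN).
by apply: (link_trans nN (link_sym nN _)); exact: link_e1.
Qed.

(** The intermediate vector [- b *: e1 + b *: e'] pairs with [e] like a multiple of [v], and with
    [f1] like [- b *: e1]. *)
Lemma link_dual v e e' : e1_orbit e -> ~ J (omega e v) ->
  omega e e' = 1 -> omega e e1 = 0 -> omega f1 e' = 0 ->
  exists a, [/\ link N (a *: v) (- b *: e1) & ~ J a].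
Proof.
move=> oe Jev ee' ee1 fe'; have [c Jc] := invJ Jev.
have Jb : J (omega e ((b * c) *: v) - b).
  rewrite omegaZr; apply: (set_mem_eq _ (JM (- b) Jc)); ring.
exists (b * c); split; last first.
  move=> Jbc; apply: Jw; apply: (set_mem_eq _ (idealB iJ (JM (omega e v) Jbc) Jb)).
  by rewrite omegaZr -/b; ring.
have fe1 : omega f1 (- b *: e1) = b by rewrite omegaZr omega_f1l mxE /=; ring.
apply: (link_trans nN (y := - b *: e1 + b *: e')).
  apply: (link_orbit oe Jb).
  by rewrite omegaDr !omegaZr ee' ee1 mulr0 add0r mulr1 subrr.
by apply: (link_orbit (orbit_f1 R)); rewrite ?omegaDr fe1 ?omegaZr ?fe' ?mulr0 ?addr0 subrr.
Qed.

(** Some coordinate of [v] lies outside [J]. For the last three, [link_dual] applies with [e1], [e2]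
    or [f2]; the first pairs with [f1] and needs no intermediate vector. *)
Lemma link_line v : (exists z, ~ J (omega z v)) -> exists a, link N v (a *: e1).
Proof.
move=> [z Jzv].
suff [a [lav Ja]] : exists a, [/\ link N (a *: v) (- b *: e1) & ~ J a].
  have [a' Jaa] := invJ Ja; exists (a' * - b).
  rewrite -scalerA; apply: (link_trans nN _ (linkZ a' lav)).
  apply: (link_cong iJ JN) => i; rewrite !mxE.
  by apply: (set_mem_eq _ (JM (v i 0) Jaa)); ring.
have [J2|/contrapT J2] := pselect (~ J (v i2 0)).
  apply: (@link_dual v e1 f1); rewrite ?omega_e1l ?omega_f1l ?mxE ?oppr0 //; exact: (orbit_e1 R).
have [J3|/contrapT J3] := pselect (~ J (v i3 0)).
  apply: (@link_dual v e2 f2); rewrite ?omega_e2l ?omega_f1l ?mxE ?oppr0 //; exact: (orbit_e2 R).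
have [J1'|/contrapT J1'] := pselect (~ J (v i1 0)).
  apply: (@link_dual v f2 (- e2)); rewrite ?omega_f2l ?omega_f1l ?mxE /= ?mxE ?oppr0 ?opprK //.
  - exact: (orbit_f2 R).
  - by move=> /(idealN iJ); rewrite opprK.
have J0' : ~ J (v i0 0).
  move=> J0'; apply: Jzv; rewrite /omega.
  by apply: idealB => //; [apply: idealB => //; [apply: JD|]|]; exact: JM.
have [c Jc] := invJ J0'; exists (- b * c); split; last first.
  move=> Jbc; apply: Jw; rewrite -/b.
  by apply: (set_mem_eq _ (JD (JM b Jc) (JM (- v i0 0) Jbc))); ring.
apply: (link_orbit (orbit_f1 R)); rewrite omegaZr omega_f1l.
  by apply: (set_mem_eq _ (JM (- b) Jc)); ring.
by rewrite mxE /= mulrN mulr1 opprK subrr.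
Qed.

Hypotheses (piR : pi_regular_quotients R) (pN : perfect_mod N).

(* Iwasawa's argument, applied to the root subgroup of transvections along [e1]. *)
Lemma normal_full g : N g.
Proof.
pose X : set (Sp4 R) := [set h | exists r, h = tv e1 r].
have sX : subgroup X.
  split; first by exists 0; rewrite tv0.
  by move=> _ _ [r ->] [s ->]; exists (r - s); rewrite tvD tvN.
(* By [link_line], each conjugate of [tv e1 r] agrees modulo [N] with an element of [X]. *)
have nM : normal_subgroup (prodset N X).
  apply: prodset_normal => // _ {}g [r ->]; rewrite tvJ.
  have [|a la] := @link_line (act g^-1%g e1).
    exists (act g^-1%g f1); rewrite omega_act omega_f1l mxE /= => Jn1.
    by apply: J1; rewrite -[1]opprK; exact: idealN.
  exists (tv (act g^-1 e1) r / tv (a *: e1) r)%g, (tv e1 (a ^+ 2 * r)); split.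
  - exact: la.
  - by exists (a ^+ 2 * r).
  - by rewrite -tvZ mulgVK.
have M_full : forall h, prodset N X h.
  apply: pN => //; first by apply: prodset_subl; case: sX.
  (* At level [1] the congruence subgroup is the whole group, so the reduction puts all commutators
     in [N X]. *)
  have Me1 : level_ge (prodset N X) e1 1.
    by move=> r; apply: prodset_subr; [case: nN => -[]|rewrite mul1r; exists r].
  apply: (commutator_sub_of_congruence nM Me1 piR) => h.
  apply: prodset_subr; first by case: nM => -[].
  by move=> x i; exists (act h x i 0 - x i 0); rewrite mul1r.
(* Now [G / N] is the image of the abelian group [X], and it is perfect. *)
apply: pN => // x y; have [n [_ [Nn [r ->] ->]]] := M_full x.
have [n' [_ [Nn' [s ->] ->]]] := M_full y.
have := eqmodR nN (eqmod_mul (tv e1 r) Nn) (eqmod_mul (tv e1 s) Nn').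
rewrite (_ : [~ tv e1 r, tv e1 s] = 1)%g; first exact: eqmod1.
by apply/eqP/commgP; rewrite /commute -!tvD addrC.
Qed.

End Iwasawa.

Section Full.
Variable N : set (Sp4 R).
Hypotheses (nN : normal_subgroup N) (pN : perfect_mod N) (piR : pi_regular_quotients R).

Definition full_mod J := forall g, prodset N (congruence_subgroup J) g.

(** Iwasawa's criterion is applied to [N G(J)], which contains [G(J)] and inherits the links and the
    perfect quotient from [N]. *)
Lemma full_mod_prime J A : is_ideal J -> ~ J 1 ->
  (forall a b, J (a * b) -> J a \/ J b) ->
  (forall a, ~ J a -> exists a', J (1 - a * a')) ->
  N A -> ~ scalar_mod J A -> full_mod J.
Proof.
move=> iJ J1 pJ invJ NA nsA.
have [w ew Jw] := link_nonorthogonal nN iJ pJ NA nsA.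
have [G1 _] := (congruence_normal iJ).1; have [[N1 _] _] := nN.
have NM : N `<=` prodset N (congruence_subgroup J) by exact: prodset_subl.
apply: (@normal_full _ J _ _ _ J1 invJ w _ Jw piR) => //.
- exact: prodset_normal2 nN (congruence_normal iJ).
- exact: prodset_subr.
- by move=> r; apply: NM; exact: ew.
- exact: perfect_mod_sub NM pN.
Qed.

Lemma full_modM I J K : is_ideal I -> is_ideal J -> is_ideal K ->
  (forall a b, I a -> J b -> K (a * b)) -> full_mod I -> full_mod J -> full_mod K.
Proof.
move=> iI iJ iK IJK fI fJ; apply: (perfect_mod_comm nN pN _ fI fJ).
  exact: congruence_normal.
by move=> g h; exact: congruence_comm.
Qed.

Lemma full_mod_top J : J 1 -> is_ideal J -> full_mod J.
Proof.
move=> J1 iJ g; apply: prodset_subr; first by case: nN => -[].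
by move=> x i; rewrite -[X in J X]mulr1; case: iJ => _ _; apply.
Qed.

Lemma full_of_level c : level_ge N e1 c -> full_mod (principal c) -> forall g, N g.
Proof. by move=> Nc fc; apply: pN => //; exact: commutator_sub_of_congruence Nc piR fc. Qed.

End Full.
End Maximal.

(** * Rings of finite rank *)

(* The additive group of [R] has finite rank; the relations between [d] elements
   are encoded as integer polynomials. *)
Definition finite_rank (R : comNzRingType) := exists d, forall x : nat -> R,
  exists q : {poly int}, [/\ (size q <= d)%N, zcontents q = 1 &
    \sum_(i < d) (q`_i)%:~R * x i = 0].

Section FiniteRank.
Variable R : comNzRingType.
Implicit Types (a b c r : R) (J : set R) (N : set (Sp4 R)).

Hypothesis domR : forall a b, a * b = 0 -> a = 0 \/ b = 0.
Hypothesis charR : forall n, n%:R = 0 :> R -> n = 0%N.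
Hypothesis rankR : finite_rank R.

Lemma Bezout_prime p (a : int) : prime p -> ~~ (p %| a)%Z ->
  exists u v : int, u * a + v * p = 1.
Proof.
move=> pp npa; have [u [v uv]] := Bezoutz a p; exists u, v; rewrite uv.
by apply/eqP; rewrite -/(coprimez a p) coprimezE coprime_sym absz_nat prime_coprime.
Qed.

Definition ieval (q : {poly int}) b : R := (map_poly intr q).[b].

Lemma ieval_cons q (a : int) b : ieval (q * 'X + a%:P) b = ieval q b * b + a%:~R.
Proof. by rewrite /ieval rmorphD rmorphM /= map_polyX map_polyC !hornerE. Qed.

Lemma coef_cons (q : {poly int}) (a : int) i :
  (q * 'X + a%:P)`_i = if i is i'.+1 then q`_i' else a.
Proof. by rewrite coefD coefMX coefC; case: i => [|i] /=; rewrite ?add0r ?addr0. Qed.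

Lemma ieval_relation b : exists2 q, zcontents q = 1 & ieval q b = 0.
Proof.
have [d /(_ (fun i => b ^+ i))[q [sq q1 rel]]] := rankR; exists q => //.
rewrite -{}rel /ieval (horner_coef_wide _ (n := d)); last first.
  exact: leq_trans (size_poly _ _) sq.
by apply: eq_bigr => i _; rewrite coef_map.
Qed.

Lemma contents1_coef q p : zcontents q = 1 -> prime p -> exists i, ~~ (p %| q`_i)%Z.
Proof.
move=> q1 pp; apply: contrapT => no.
have : (p %| zcontents q)%Z.
  rewrite dvdz_contents; apply/polyOverP => i; apply: contrapT => /negP npi.
  by apply: no; exists i.
by rewrite q1 dvdzE /= dvdn1 => /eqP p1; rewrite p1 in pp.
Qed.

Definition pi_regular_mod n := forall b, exists k w q, b ^+ k * (1 - b * w) = n%:R * q.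

(** A primitive relation for [b] is nonzero modulo [p]; scaling its lowest nonzero coefficient there
    to [1] gives the form [b ^+ k * (1 - b * w)]. *)
Lemma pi_regular_prime p : prime p -> pi_regular_mod p.
Proof.
move=> pp b; have [q q1 qb] := ieval_relation b.
have [i npi] := contents1_coef q1 pp.
suff [k [w [c [r E]]]] : exists k w c r, b ^+ k * (1 - b * w) = c * ieval q b + p%:R * r.
  by exists k, w, r; rewrite E qb mulr0 add0r.
elim/poly_ind: q i npi {q1 qb} => [|q a IH] i npi; first by rewrite coef0 dvdz0 in npi.
have [/dvdzP[a' aE]|npa] := boolP (p %| a)%Z; last first.
  have [u [v uv]] := Bezout_prime pp npa.
  exists 0%N, (- u%:~R * ieval q b), u%:~R, v%:~R.
  have {}uv : u%:~R * a%:~R + v%:~R * p%:R = 1 :> R.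
    by rewrite -[p%:R]/(p%:~R) -!intrM -intrD uv.
  by rewrite ieval_cons -[X in _ * (X - _)]uv expr0; ring.
case: i npi => [|i]; rewrite coef_cons => npi; first by rewrite aE dvdz_mull in npi.
have [k [w [c [r E]]]] := IH i npi.
exists k.+1, w, c, (b * r - c * a'%:~R).
rewrite exprS -mulrA E ieval_cons aE intrM -[p%:~R]/(p%:R); ring.
Qed.

Lemma nat_prime_ind (P : nat -> Prop) : P 1%N -> (forall p, prime p -> P p) ->
  (forall m n, P m -> P n -> P (m * n)%N) -> forall n, (0 < n)%N -> P n.
Proof.
move=> P1 Pp PM; elim/ltn_ind => n IH n0; have [n1|n1] := leqP n 1.
  by have -> : n = 1%N by apply/eqP; rewrite eqn_leq n1.
have pp := pdiv_prime n1; rewrite -(divnK (pdiv_dvd n)); apply: PM; last exact: Pp.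
apply: IH; first by apply: ltn_Pdiv => //; exact: prime_gt1.
by rewrite divn_gt0 ?pdiv_gt0 // dvdn_leq ?pdiv_dvd.
Qed.

Lemma pi_regular_nat n : (0 < n)%N -> pi_regular_mod n.
Proof.
move: n; apply: nat_prime_ind => [b|p pp|m n Pm Pn b].
- by exists 0%N, 0, 1; rewrite expr0 !mulr0 subr0 mulr1.
- exact: pi_regular_prime.
have [k [w [q E]]] := Pm b; have [k' [w' [q' E']]] := Pn b.
exists (k + k')%N, (w + w' - b * w * w'), (q * q').
by rewrite natrM mulrACA -E -E' exprD; ring.
Qed.

(** After cancelling powers of [a] from a polynomial relation, the constant term is a nonzero
    integer divisible by [a]. *)
Lemma divides_nat a : a != 0 -> exists n c, (0 < n)%N /\ n%:R = a * c.
Proof.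
move=> a0; have [q q1 qa] := ieval_relation a.
have q0 : q != 0 by apply/eqP => q0; rewrite q0 zcontents0 in q1.
elim/poly_ind: q q0 qa {q1} => [|q b IH]; first by rewrite eqxx.
have [-> qX0|b0 _] := eqVneq b 0; rewrite ieval_cons.
  rewrite mulr0z addr0 => /domR[|/eqP]; last by rewrite (negPf a0).
  by apply: IH; apply: contraNneq qX0 => ->; rewrite mul0r addr0.
move=> /eqP; rewrite addr_eq0 mulrC => /eqP E.
exists `|b|%N; rewrite absz_gt0 b0.
have [bE|bE] : b = `|b|%N \/ b = - `|b|%N%:Z by lia.
  exists (- ieval q a); split=> //; rewrite mulrN E opprK.
  by rewrite {2}bE.
exists (ieval q a); split=> //; rewrite E {2}bE.
by rewrite -mulrNz opprK.
Qed.

Lemma finite_rank_pi_regular : pi_regular_quotients R.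
Proof.
move=> a b a0; have [n [c [n0 E]]] := divides_nat a0.
have [k [w [q Eb]]] := pi_regular_nat n0 b.
by exists k, w, (c * q); rewrite Eb E mulrA.
Qed.

Definition adjoin J a : set R := [set x | exists j r, J j /\ x = j + a * r].

Lemma adjoin_ideal J a : is_ideal J -> is_ideal (adjoin J a).
Proof.
case=> J0 JD JM; split; first by exists 0, 0; rewrite mulr0 addr0.
  move=> _ _ [j [r [Jj ->]]] [j' [r' [Jj' ->]]]; exists (j + j'), (r + r').
  by split; [exact: JD|ring].
move=> b _ [j [r [Jj ->]]]; exists (b * j), (b * r); split; [exact: JM|ring].
Qed.

Lemma adjoin_sub J a : J `<=` adjoin J a.
Proof. by move=> j Jj; exists j, 0; rewrite mulr0 addr0. Qed.

Lemma adjoin_self J a : is_ideal J -> adjoin J a a.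
Proof. by case=> J0 _ _; exists 0, 1; rewrite mulr1 add0r. Qed.

Lemma adjoinM J a b x y : is_ideal J -> J (a * b) ->
  adjoin J a x -> adjoin J b y -> J (x * y).
Proof.
move=> [J0 JD JM] Jab [j [r [Jj ->]]] [j' [r' [Jj' ->]]].
rewrite (_ : _ * _ = j' * j + (b * r') * j +
  ((a * r) * j' + (r * r') * (a * b))); last by ring.
by apply: (JD); apply: (JD); apply: JM.
Qed.

Definition prime_ideal J := ~ J 1 /\ forall a b, J (a * b) -> J a \/ J b.

(* Noetherian induction: the number of elements of [J] that are linearly
   independent over the field with [p] elements in [R / p R] is bounded. *)
Lemma ideal_ind p (P : set R -> Prop) : prime p ->
  (forall J, is_ideal J -> J p%:R -> J 1 -> P J) ->
  (forall J, is_ideal J -> J p%:R -> prime_ideal J -> P J) ->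
  (forall J a b, is_ideal J -> J p%:R -> J (a * b) ->
     P (adjoin J a) -> P (adjoin J b) -> P J) ->
  forall J, is_ideal J -> J p%:R -> P J.
Proof.
move=> pp P1 Pprime Padj.
pose indep k J := exists x : nat -> R, (forall i, (i < k)%N -> J (x i)) /\
  forall n : nat -> int, (exists r, \sum_(i < k) (n i)%:~R * x i = p%:R * r) ->
    forall i, (i < k)%N -> (p %| n i)%Z.
have [d rel] := rankR.
(* The induction variable [m] counts the independent elements still missing from the bound [d]. *)
suff H m : forall k J, (k + m = d)%N -> is_ideal J -> J p%:R -> indep k J -> P J.
  move=> J iJ Jp; apply: (H d 0%N) => //; exists (fun=> 0).
  by split=> // n _ i; rewrite ltn0.
elim: m => [|m IH] k J km iJ Jp [x [Jx indx]].
  (* With [k = d] the finite-rank relation has a coefficient prime to [p], contradicting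
     independence. *)
  exfalso; rewrite addn0 in km; have [q [sq q1 Eq]] := rel x.
  have [i npi] := contents1_coef q1 pp.
  have [ik|ki] := ltnP i k; last first.
    by rewrite nth_default ?dvdz0 // in npi; rewrite (leq_trans sq) // -km.
  move/negP: npi; apply; apply: indx ik; exists 0; rewrite mulr0 km.
  exact: Eq.
have step a : ~ J a -> P (adjoin J a).
  move=> nJa; apply: (IH k.+1); rewrite ?addSnnS //; first exact: adjoin_ideal.
    exact: adjoin_sub.
  exists (fun i => if (i < k)%N then x i else a); split.
    move=> i _; case: ltnP => ik; last exact: adjoin_self.
    by apply: adjoin_sub; exact: Jx.
  move=> n [r]; rewrite big_ord_recr /= ltnn.
  under eq_bigr do rewrite ltn_ord.
  move=> E; have [J0 JD JM] := iJ.
  (* Otherwise [n k] is invertible modulo [p]; as [J] contains [p] and the [x i], the relation would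
     put [a] in [J]. *)
  have pnk : (p %| n k)%Z.
    apply: contrapT => /negP /(Bezout_prime pp)[u [v uv]]; apply: nJa.
    have {}uv : u%:~R * (n k)%:~R + v%:~R * p%:R = 1 :> R.
      by rewrite -[p%:R]/(p%:~R) -!intrM -intrD uv.
    rewrite -[a]mul1r -uv.
    rewrite (_ : _ * a = - u%:~R * (\sum_(i < k) (n i)%:~R * x i) +
      (v%:~R * a + u%:~R * r) * p%:R).
      apply: (JD); apply: (JM) => //.
      by elim/big_ind: _ => // i _; apply: JM; apply: Jx.
    have -> : \sum_(i < k) (n i)%:~R * x i = p%:R * r - (n k)%:~R * a by rewrite -E addrK.
    by ring.
  move=> i; rewrite ltnS leq_eqVlt => /orP[/eqP-> //|ik].
  apply: indx ik; have [c nkE] := dvdzP pnk.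
  exists (r - c%:~R * a).
  have -> : \sum_(i < k) (n i)%:~R * x i = p%:R * r - (n k)%:~R * a by rewrite -E addrK.
  by rewrite nkE intrM -[p%:~R]/(p%:R); ring.
have [J1|J1] := pselect (J 1); first exact: P1.
have [pJ|npJ] := pselect (prime_ideal J); first exact: Pprime.
apply: contrapT => nP; apply: npJ; split=> // a b Jab.
have [Ja|nJa] := pselect (J a); first by left.
have [Jb|nJb] := pselect (J b); first by right.
by exfalso; apply: nP; apply: (Padj J a b) => //; exact: step.
Qed.

Lemma prime_ideal_maximal J c : is_ideal J -> prime_ideal J -> J c -> c != 0 ->
  forall a, ~ J a -> exists a', J (1 - a * a').
Proof.
move=> iJ [J1 pJ] Jc c0 a nJa; have [_ _ JM] := iJ.
have [k [w [q E]]] := finite_rank_pi_regular a c0; exists w.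
have : J (a ^+ k * (1 - a * w)) by rewrite E mulrC; exact: JM.
move=> /pJ[Jak|//]; exfalso.
by elim: k Jak {E} => [|k IH]; [rewrite expr0|rewrite exprS => /pJ[]].
Qed.

Lemma zero_ideal : is_ideal [set 0 : R].
Proof.
split=> //; first by move=> _ _ -> ->; rewrite /= addr0.
by move=> a _ ->; rewrite /= mulr0.
Qed.

Section Main.
Variable N : set (Sp4 R).
Hypotheses (nN : normal_subgroup N) (pN : perfect_mod N).
Hypothesis nonscalarN : forall J, is_ideal J -> ~ J 1 ->
  (forall a, ~ J a -> exists a', J (1 - a * a')) ->
  exists2 A, N A & ~ scalar_mod J A.

Let piR := finite_rank_pi_regular.

Lemma natr_neq0 n : (0 < n)%N -> n%:R != 0 :> R.
Proof. by case: n => // n _; apply/eqP => /charR. Qed.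

(** For prime [n], Iwasawa's criterion settles the prime ideals above [n], and products of ideals
    carry the result down to [n R]; products also give composite [n]. *)
Lemma full_mod_nat n : (0 < n)%N -> full_mod N (principal n%:R).
Proof.
move: n; apply: nat_prime_ind => [|p pp|m n fm fn].
- by apply: full_mod_top => //; [exists 1; rewrite mulr1|exact: principal_ideal].
- apply: (ideal_ind pp (P := full_mod N)) => [J iJ _ J1|J iJ Jp pJ|J a b iJ _ Jab fa fb||].
  + exact: full_mod_top.
  + have invJ := prime_ideal_maximal iJ pJ Jp (natr_neq0 (prime_gt0 pp)).
    have [J1 pJ'] := pJ; have [A NA nsA] := nonscalarN iJ J1 invJ.
    exact: (full_mod_prime nN pN piR iJ J1 pJ' invJ NA nsA).
  + apply: (full_modM nN pN _ _ iJ _ fa fb); try exact: adjoin_ideal.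
    by move=> x y; exact: adjoinM.
  + exact: principal_ideal.
  + by exists 1; rewrite mulr1.
- apply: (full_modM nN pN _ _ _ _ fm fn); try exact: principal_ideal.
  by move=> _ _ [a ->] [b ->]; exists (a * b); rewrite natrM mulrACA.
Qed.

Lemma full_mod_nonzero c : c != 0 -> full_mod N (principal c).
Proof.
move=> c0 g; have [n [a [n0 E]]] := divides_nat c0.
have [m [h [Nm Gh ->]]] := full_mod_nat n0 g; exists m, h; split=> //.
by move=> x i; have [r Er] := Gh x i; exists (a * r); rewrite Er E mulrA.
Qed.

Lemma level_of_prime J : is_ideal J -> prime_ideal J ->
  (forall a, ~ J a -> exists a', J (1 - a * a')) ->
  exists2 c, c != 0 & level_ge N (e1 R) c.
Proof.
move=> iJ [J1 pJ] invJ; have [A NA nsA] := nonscalarN iJ J1 invJ.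
have [w ew Jw] := link_nonorthogonal nN iJ pJ NA nsA.
exists (4 * omega (e1 R) w ^+ 4); last exact: level_of_link.
have w0 : omega (e1 R) w != 0 by apply/eqP => w0; apply: Jw; rewrite w0; case: iJ.
have nz a b : a != 0 -> b != 0 -> a * b != 0.
  by move=> /eqP a0 /eqP b0; apply/eqP => /domR[].
have nzX k a : a != 0 -> a ^+ k != 0.
  by move=> a0; elim: k => [|k IH]; rewrite ?expr0 ?oner_eq0 // exprS; exact: nz.
by apply: nz; [exact: natr_neq0|exact: nzX].
Qed.

(** Only one prime ideal with field quotient has to be found. If some prime number is not a unit,
    induction finds one above it; otherwise all positive integers are units, [R] is a field and the
    zero ideal serves. *)
Lemma level_nonzero : exists2 c, c != 0 & level_ge N (e1 R) c.
Proof.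
have [[p pp np1]|units] :=
    pselect (exists2 p, prime p & ~ principal (p%:R : R) 1).
  pose P J := J 1 \/ exists2 c, c != 0 & level_ge N (e1 R) c.
  suff [] : P (principal p%:R) by [].
  apply: (ideal_ind pp (P := P)) => [J _ _ J1|J iJ Jp pJ|J a b iJ _ Jab||].
  - by left.
  - right; apply: (level_of_prime iJ pJ).
    exact: prime_ideal_maximal iJ pJ Jp (natr_neq0 (prime_gt0 pp)).
  - move=> [Ja1|]; last by right.
    by move=> [Jb1|]; [left; rewrite -[1]mulr1; exact: adjoinM Jab Ja1 Jb1|right].
  - exact: principal_ideal.
  - by exists 1; rewrite mulr1.
have unit_nat n : (0 < n)%N -> exists r, 1 = n%:R * r :> R.
  move: n; apply: nat_prime_ind => [|p pp|m n [r Er] [s Es]].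
  - by exists 1; rewrite mulr1.
  - by apply: contrapT => nr; apply: units; exists p.
  - by exists (r * s); rewrite natrM mulrACA -Er -Es mulr1.
apply: (level_of_prime zero_ideal).
  by split; [apply/eqP; exact: oner_neq0|move=> a b /domR].
move=> a /eqP a0; have [n [c [n0 E]]] := divides_nat a0.
have [r Er] := unit_nat n n0; exists (c * r).
by rewrite /= mulrA -E -Er subrr.
Qed.

Lemma normal_subgroup_full g : N g.
Proof.
have [c c0 Nc] := level_nonzero.
exact: (full_of_level nN pN piR Nc (full_mod_nonzero c0)).
Qed.

End Main.
End FiniteRank.

(** * The main theorem *)

Section Reductions.
Variable R : comNzRingType.
Implicit Types (T : set (Sp4 R)).

Lemma maximal_idealr (J : set R) : is_ideal J -> ~ J 1 ->
  (forall a, ~ J a -> exists a', J (1 - a * a')) ->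
  exists m : idealr R, maximal_ideal m /\ forall x, x \in m <-> J x.
Proof.
move=> iJ J1 invJ; have [J0 JD JM] := iJ.
pose S : {pred R} := fun x => `[< J x >].
have clS : idealr_closed S.
  split; first exact/asboolP.
    by apply/negP => /asboolP.
  by move=> a x y /asboolP Jx /asboolP Jy; apply/asboolP; apply: JD => //; exact: JM.
pose m : idealr R := HB.pack S (isIdealr.Build R S clS).
have mE x : x \in m <-> J x by split=> [/asboolP|Jx] //; exact/asboolP.
exists m; split=> // I mI x; apply/idP/idP; last exact: mI.
move=> Ix; apply/mE; apply: contrapT => /invJ[y Jxy].
have := idealr1 I; rewrite -[X in X \in I](subrK (x * y)) rpredD //.
  by apply: mI; apply/mE.
by rewrite mulrC idealMr.
Qed.

Lemma central_of_scalar (m : idealr R) (A : Sp4 R) :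
  scalar_mod [set x | x \in m] A -> group_center (Sp4_red m A).
Proof.
move=> [a Aa] B; apply: val_inj => /=.
suff -> : map_mx \pi_{ideal_quot m} (A : 'M_4) = (\pi_{ideal_quot m} a)%:M.
  by rewrite scalar_mxC.
apply/matrixP => i j; rewrite !mxE.
have := Aa (delta_mx j 0) i; rewrite /act -colE !mxE /= => mij.
rewrite -rmorphMn /=; apply/eqP; rewrite -Quotient.idealrBE.
by move: mij; rewrite andbT mulr_natr.
Qed.

Lemma Sp4_redM (m : idealr R) (A B : Sp4 R) :
  Sp4_red m (A * B)%g = (Sp4_red m A * Sp4_red m B)%g.
Proof. by apply: val_inj => /=; rewrite map_mxM. Qed.

Lemma Sp4_red1 (m : idealr R) : Sp4_red m 1%g = 1%g.
Proof. by apply: val_inj => /=; rewrite map_mx1. Qed.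

Lemma Sp4_redV (m : idealr R) (A : Sp4 R) : Sp4_red m A^-1%g = (Sp4_red m A)^-1%g.
Proof. by apply/esym/mulg1_eq; rewrite -Sp4_redM mulgV Sp4_red1. Qed.

Lemma center_preim_normal (m : idealr R) :
  normal_subgroup [set A | group_center (Sp4_red m A)].
Proof.
have cM (A B : Sp4 R) : group_center (Sp4_red m A) -> group_center (Sp4_red m B) ->
    group_center (Sp4_red m (A * B)%g).
  move=> cA cB C; rewrite Sp4_redM; apply: commute_sym.
  by apply: commuteM; apply: commute_sym.
split; first split.
- by move=> C; rewrite Sp4_red1; apply: commute_sym; exact: commute1.
- move=> A B cA cB; apply: cM => // C; rewrite Sp4_redV.
  by apply: commute_sym; apply: commuteV; apply: commute_sym.
- move=> A B cA C; rewrite conjgE !Sp4_redM Sp4_redV.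
  by rewrite (cA (Sp4_red m B)) mulKg; exact: cA.
Qed.

(** Otherwise all of [Sp4 R] would be central modulo some [m], but the two orders of multiplying
    [tv e1 1] and [tv f1 1] have top left entries [0] and [1]. *)
Lemma Pi_set0_of_normally_generates T : normally_generates T -> Pi_set T = set0.
Proof.
move=> nT; apply/seteqP; split=> // M [m [_ _ cT]].
have all_central A : group_center (Sp4_red m A).
  have sub := normal_closure_min (center_preim_normal m) cT.
  by apply: sub; rewrite nT.
pose A := tv (e1 R) 1; pose B := tv (f1 R) 1.
have /(congr1 (@Sp4_mx _)) /= := all_central A (Sp4_red m B).
rewrite -!map_mxM => /matrixP/(_ i0 i0); rewrite !mxE => /eqP.
rewrite -Quotient.idealrBE => E.
have colA C : (C : 'M[R]_4) i0 i0 = (C *m e1 R) i0 0.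
  rewrite (_ : e1 R = delta_mx i0 0) -?colE ?mxE //.
  by apply/colP; elim/ord4P; rewrite !mxE.
have := idealr1 m; suff -> : 1 = - (\sum_j A i0 j * B j i0 - \sum_j B i0 j * A j i0).
  by rewrite rpredN E.
have -> : \sum_j A i0 j * B j i0 = ((A : 'M[R]_4) *m B) i0 i0 by rewrite mxE.
have -> : \sum_j B i0 j * A j i0 = ((B : 'M[R]_4) *m A) i0 i0 by rewrite mxE.
rewrite !colA -!mulmxA -![_ *m (_ *m e1 R)]/(act _ (act _ (e1 R))).
rewrite [act B (e1 R)]tv_f1E [act A (e1 R)]tv_e1E tv_e1E tv_f1E !mxE /=; ring.
Qed.

Lemma nonscalar_of_Pi_set0 T : Pi_set T = set0 ->
  forall J, is_ideal J -> ~ J 1 -> (forall a, ~ J a -> exists a', J (1 - a * a')) ->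
  exists2 A, normal_closure T A & ~ scalar_mod J A.
Proof.
move=> PT J iJ J1 invJ; have [m [maxm mE]] := maximal_idealr iJ J1 invJ.
have mJ : [set x | x \in m] = J by apply/seteqP; split=> x /mE.
apply: contrapT => no.
suff : Pi_set T [set x | x \in m] by rewrite PT.
exists m; split=> // B TB; apply: central_of_scalar; rewrite mJ.
apply: contrapT => nsB; apply: no; exists B => //.
exact: normal_closure_sub.
Qed.

End Reductions.

(** * Finite rank of rings of S-integers *)

Section SIntegers.
Variables (RR : realType) (K : fieldExtType rat) (S : place_set RR K).
Local Notation R := (S_integers S).

Lemma S_integers_domain (a b : R) : a * b = 0 -> a = 0 \/ b = 0.
Proof.
move=> /(congr1 val); rewrite rmorphM rmorph0 => /eqP.
by rewrite mulf_eq0 => /orP[]/eqP ab0; [left|right]; apply: val_inj; rewrite ab0 rmorph0.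
Qed.

Lemma S_integers_char0 n : n%:R = 0 :> R -> n = 0%N.
Proof.
move=> /(congr1 val); rewrite rmorph_nat rmorph0 => /eqP.
rewrite -[n%:R in X in X -> _]/(n%:R : K) -(scaler_nat n (1 : K)).
by rewrite scaler_eq0 oner_eq0 orbF pnatr_eq0 => /eqP.
Qed.

(** One element more than the dimension of [K] forces a rational dependence; clearing denominators
    and dividing by the content makes it primitive. *)
Lemma S_integers_finite_rank : finite_rank R.
Proof.
pose d := (\dim {:K}).+1; exists d => x.
pose X := [tuple val (x i) | i < d].
have nfree : ~~ free X.
  apply/negP => /eqP fX; have := dimvS (subvf <<X>>%VS).
  by rewrite fX size_tuple ltnn.
have [k rel [i ki]] : exists2 k : 'I_d -> rat,
    \sum_(i < d) k i *: val (x i) = 0 & exists i, k i != 0.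
  apply: contrapT => no; move/negP: nfree; apply; apply/freeP => k rel i.
  apply: contrapT => /eqP ki; apply: no; exists k; last by exists i.
  rewrite -[RHS]rel; apply: eq_bigr => j _.
  by rewrite -tnth_nth tnth_mktuple.
pose p := \poly_(i < d) k (inord i).
have [q [a a0 pq]] := rat_poly_scale p.
have kE (j : 'I_d) : (q`_j)%:~R = a%:~R * k j.
  have /polyP/(_ j) := pq.
  rewrite coef_poly ltn_ord coefZ coef_map /= inord_val => ->.
  by rewrite mulrA mulfV ?mul1r ?intr_eq0.
have q0 : q != 0.
  apply/eqP => q0; have := kE i; rewrite q0 coef0 => /esym/eqP.
  by rewrite mulf_eq0 intr_eq0 (negPf a0) (negPf ki).
have sq : (size q <= d)%N.
  rewrite -(size_map_inj_poly (@intr_inj rat)) //.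
  have -> : map_poly intr q = a%:~R *: p by rewrite pq scalerA mulfV ?scale1r ?intr_eq0.
  exact: leq_trans (size_scale_leq _ _) (size_poly _ _).
exists (zprimitive q); split.
- by apply: leq_trans sq; rewrite size_zprimitive.
- by rewrite zcontents_primitive q0.
(* The content is cancelled in [K], where nonzero rational scalars are injective. *)
have c0 : (zcontents q)%:~R != 0 :> rat by rewrite intr_eq0 zcontents_eq0.
apply: val_inj; rewrite rmorph_sum rmorph0; apply: (scalerI c0); rewrite scaler0.
have arel : \sum_(i < d) a%:~R *: (k i *: val (x i)) = 0.
  by rewrite -scaler_sumr rel scaler0.
rewrite scaler_sumr -[RHS]arel; apply: eq_bigr => j _.
have qj : q`_j = zcontents q * (zprimitive q)`_j by rewrite {1}(zpolyEprim q) coefZ.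
rewrite [RHS]scalerA -kE qj [X in _ = X *: _]intrM -[RHS]scalerA.
by rewrite mulrzl raddfMz !scaler_int.
Qed.

End SIntegers.

Theorem theorem4 (RR : realType) (K : fieldExtType rat) (S : place_set RR K)
    (T : set (Sp4 (S_integers S))) :
  normally_generates T <->
  Pi_set T = set0 /\ generates (@abelianize _ @` T).
Proof.
split=> [nT|[PT gT]].
  by split; [exact: Pi_set0_of_normally_generates|exact: generates_of_normally_generates].
apply/seteqP; split=> // g _.
apply: (normal_subgroup_full (@S_integers_domain _ _ S) (@S_integers_char0 _ _ S)
  (S_integers_finite_rank S) (normal_closure_normal T) (perfect_mod_of_generates gT)).
exact: nonscalar_of_Pi_set0.
Qed.
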